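(* Let $K$ be a field and let $A$ be a bounded double complex over $K$. Then there exist unique cardinal numbers $\operatorname{mult}_S(A)$, where $S$ runs over the set of all shapes of squares and zigzags, such that there is a (non-unique, non-functorial) isomorphism of double complexes $$A\cong\bigoplus_{S} C(S)^{\oplus \operatorname{mult}_S(A)} .$$ In particular, every indecomposable bounded double complex over $K$ is isomorphic to a square or a zigzag.
   Context: A double complex over a field $K$ is a bigraded $K$-vector space $A=\bigoplus_{p,q\in\mathbb{Z}}A^{p,q}$ (possibly infinite dimensional) with endomorphisms $\partial_1,\partial_2$ of bidegree $(1,0)$ and $(0,1)$ satisfying $\partial_1^2=\partial_2^2=0$ and $\partial_1\partial_2+\partial_2\partial_1=0$. It is bounded if $A^{p,q}=0$ for all but finitely many $(p,q)$. Morphisms are $K$-linear maps respecting the bigrading and $\partial_1,\partial_2$. A nonzero double complex is indecomposable if it has no nontrivial direct sum decomposition into double subcomplexes. A shape is one of the following finite subsets of $\mathbb{Z}^2$. - Square shapes: $S^{p,q}=\{(p,q),(p-1,q),(p,q-1),(p-1,q-1)\}$, for $p,q\in\mathbb{Z}$. - Even zigzag shapes, for $p,q\in\mathbb{Z}$, $r\ge 1$: $S_{1,r}^{p,q}=\{(p+j,q-j),(p+j+1,q-j)\mid 0\le j\le r-1\}$ and $S_{2,r}^{p,q}=\{(p-j,q+j),(p-j,q+j+1)\mid 0\le j\le r-1\}$. - Odd zigzag shapes, for $p,q,d\in\mathbb{Z}$: if $p+q\le d$, $S_d^{p,q}=\{(j,d-j)\mid p\le j\le d-q\}\cup\{(j,d+1-j)\mid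 p+1\le j\le d-q\}$; if $p+q> d$, $S_d^{p,q}=\{(j,d-j)\mid d-q\le j\le p\}\cup\{(j,d-1-j)\mid d-q\le j\le p-1\}$. A square (resp. zigzag) of shape $S$ is a double complex with $A^{a,b}$ one-dimensional for $(a,b)\in S$ and zero otherwise, in which every component of $\partial_1$ or $\partial_2$ between two bidegrees that both lie in $S$ is an isomorphism. Its isomorphism class is determined by $S$; $C(S)$ denotes a fixed square (resp. zigzag) of shape $S$. *)

(* Defs.v *)
From HB Require Import structures.
From mathcomp Require Import all_boot all_order all_algebra.
From mathcomp Require Import boolp classical_sets functions cardinality.
From mathcomp Require Import zify.

Set Implicit Arguments.
Unset Strict Implicit.
Unset Printing Implicit Defensive.

Import Order.TTheory GRing.Theory Num.Theory.
Local Open Scope classical_set_scope.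
Local Open Scope ring_scope.

Definition dprod (K : fieldType) (I : Type) (V : I -> lmodType K) : Type :=
  forall i, V i.

Section DProd.
Variables (K : fieldType) (I : Type) (V : I -> lmodType K).

HB.instance Definition _ := gen_eqMixin (dprod V).
HB.instance Definition _ := gen_choiceMixin (dprod V).

Let add (f g : dprod V) : dprod V := fun i => f i + g i.
Let zero : dprod V := fun i => 0.
Let opp (f : dprod V) : dprod V := fun i => - f i.
Let scale (k : K) (f : dprod V) : dprod V := fun i => k *: f i.

Let addA : associative add.
Proof. by move=> f g h; apply: functional_extensionality_dep => i; exact: addrA. Qed.
Let addC : commutative add.
Proof. by move=> f g; apply: functional_extensionality_dep => i; exact: addrC. Qed.
Let add0 : left_id zero add.
Proof. by move=> f; apply: functional_extensionality_dep => i; exact: add0r. Qed.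
Let addN : left_inverse zero opp add.
Proof. by move=> f; apply: functional_extensionality_dep => i; exact: addNr. Qed.

HB.instance Definition _ :=
  GRing.isZmodule.Build (dprod V) addA addC add0 addN.

Let scaleA k l f : scale k (scale l f) = scale (k * l) f.
Proof. by apply: functional_extensionality_dep => i; exact: scalerA. Qed.
Let scale1 : left_id 1 scale.
Proof. by move=> f; apply: functional_extensionality_dep => i; exact: scale1r. Qed.
Let scaleDr : right_distributive scale +%R.
Proof. by move=> k f g; apply: functional_extensionality_dep => i; exact: scalerDr. Qed.
Let scaleDl f : {morph scale^~ f : k l / k + l}.
Proof. by move=> k l; apply: functional_extensionality_dep => i; exact: scalerDl. Qed.

HB.instance Definition _ :=
  GRing.Zmodule_isLmodule.Build K (dprod V) scaleA scale1 scaleDr scaleDl.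

Definition fin_supp : {pred dprod V} :=
  fun f => `[< finite_set [set i | f i != 0] >].

Lemma fin_supp_submod_closed : submod_closed fin_supp.
Proof.
split=> [|k f g /asboolP ff /asboolP fg]; apply/asboolP.
  apply: (sub_finite_set _ (finite_set0 I)) => i /=.
  by rewrite eqxx.
have: finite_set ([set i | f i != 0] `|` [set i | g i != 0]) by rewrite finite_setU.
apply: sub_finite_set => i /= fgi.
have [f0|] := eqVneq (f i) 0; last by left.
right; apply: contra fgi => /eqP g0; apply/eqP.
by rewrite -[LHS]/(k *: f i + g i) f0 g0 scaler0 addr0.
Qed.

HB.instance Definition _ :=
  GRing.isSubmodClosed.Build K (dprod V) fin_supp fin_supp_submod_closed.

Record dsum : Type := DSum { dsum_val : dprod V; _ : dsum_val \in fin_supp }.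

HB.instance Definition _ := [isSub for dsum_val].
HB.instance Definition _ := [Choice of dsum by <:].
HB.instance Definition _ := [SubChoice_isSubLmodule of dsum by <:].

Lemma dsumP (f g : dsum) : (forall i, dsum_val f i = dsum_val g i) -> f = g.
Proof. by move=> fg; apply/val_inj/functional_extensionality_dep. Qed.

End DProd.

Section DSumMap.
Variables (K : fieldType) (I : Type) (V W : I -> lmodType K).
Variable h : forall i, {linear V i -> W i}.

Lemma dsum_map_subproof (f : dsum V) :
  ((fun i => h i (dsum_val f i)) : dprod W) \in @fin_supp K I W.
Proof.
case: f => f /= /asboolP ff; apply/asboolP; apply: sub_finite_set ff => i /=.
by apply: contra => /eqP ->; rewrite linear0.
Qed.

Definition dsum_map (f : dsum V) : dsum W := DSum (dsum_map_subproof f).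

Lemma dsum_map_linear : linear dsum_map.
Proof. by move=> k f g; apply: dsumP => i; exact: linearP. Qed.

HB.instance Definition _ :=
  GRing.isLinear.Build K (dsum V) (dsum W) _ dsum_map dsum_map_linear.

End DSumMap.

Record dcomplex (K : fieldType) := DComplex {
  comp :> int -> int -> lmodType K;
  d1 : forall p q, {linear comp p q -> comp (p + 1) q};
  d2 : forall p q, {linear comp p q -> comp p (q + 1)};
  d1d1 : forall p q x, d1 (p + 1) q (d1 p q x) = 0;
  d2d2 : forall p q x, d2 p (q + 1) (d2 p q x) = 0;
  d1d2 : forall p q x, d1 p (q + 1) (d2 p q x) + d2 (p + 1) q (d1 p q x) = 0
}.
Arguments d1 {K} A p q : rename.
Arguments d2 {K} A p q : rename.

Record dmorphism (K : fieldType) (A B : dcomplex K) := DMorphism {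
  dmap :> forall p q, {linear A p q -> B p q};
  dmap_d1 : forall p q x, dmap (p + 1) q (d1 A p q x) = d1 B p q (dmap p q x);
  dmap_d2 : forall p q x, dmap p (q + 1) (d2 A p q x) = d2 B p q (dmap p q x)
}.

Definition disomorphic (K : fieldType) (A B : dcomplex K) : Prop :=
  exists (f : dmorphism A B) (g : dmorphism B A),
    forall p q, cancel (f p q) (g p q) /\ cancel (g p q) (f p q).

Definition dbounded (K : fieldType) (A : dcomplex K) : Prop :=
  finite_set [set pq : int * int | exists x : A pq.1 pq.2, x != 0].

Definition dsubcomplex (K : fieldType) (A : dcomplex K)
    (U : forall p q, {pred A p q}) : Prop :=
  [/\ forall p q, submod_closed (U p q),
      forall p q x, x \in U p q -> d1 A p q x \in U (p + 1) q
    & forall p q x, x \in U p q -> d2 A p q x \in U p (q + 1)].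

Definition dzero (K : fieldType) (A : dcomplex K)
    (U : forall p q, {pred A p q}) : Prop :=
  forall p q x, x \in U p q -> x = 0.

Definition ddirect (K : fieldType) (A : dcomplex K)
    (U W : forall p q, {pred A p q}) : Prop :=
  forall p q,
    (forall x, exists u w, [/\ u \in U p q, w \in W p q & x = u + w]) /\
    (forall x, x \in U p q -> x \in W p q -> x = 0).

Definition dindecomposable (K : fieldType) (A : dcomplex K) : Prop :=
  (exists p q (x : A p q), x != 0) /\
  forall U W : forall p q, {pred A p q},
    dsubcomplex U -> dsubcomplex W -> ddirect U W -> dzero U \/ dzero W.

Section DComplexSum.
Variables (K : fieldType) (I : Type) (B : I -> dcomplex K).

Let V p q i : lmodType K := B i p q.
Let e1 p q : {linear dsum (V p q) -> dsum (V (p + 1) q)} :=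
  dsum_map (fun i => d1 (B i) p q).
Let e2 p q : {linear dsum (V p q) -> dsum (V p (q + 1))} :=
  dsum_map (fun i => d2 (B i) p q).

Lemma dcsum_d1d1 p q x : e1 (p + 1) q (e1 p q x) = 0.
Proof. by apply: dsumP => i; exact: d1d1. Qed.
Lemma dcsum_d2d2 p q x : e2 p (q + 1) (e2 p q x) = 0.
Proof. by apply: dsumP => i; exact: d2d2. Qed.
Lemma dcsum_d1d2 p q x :
  e1 p (q + 1) (e2 p q x) + e2 (p + 1) q (e1 p q x) = 0.
Proof. by apply: dsumP => i; exact: d1d2. Qed.

Definition dcsum : dcomplex K := DComplex dcsum_d1d1 dcsum_d2d2 dcsum_d1d2.

End DComplexSum.

Definition square_pts (p q : int) : set (int * int) :=
  [set (p, q); (p - 1, q); (p, q - 1); (p - 1, q - 1)].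

Definition even1_pts (r p q : int) : set (int * int) :=
  [set x | exists j : int, 0 <= j <= r - 1 /\
     (x = (p + j, q - j) \/ x = (p + j + 1, q - j))].

Definition even2_pts (r p q : int) : set (int * int) :=
  [set x | exists j : int, 0 <= j <= r - 1 /\
     (x = (p - j, q + j) \/ x = (p - j, q + j + 1))].

Definition odd_pts (d p q : int) : set (int * int) :=
  if p + q <= d then
    [set (j, d - j) | j in [set j | p <= j <= d - q]] `|`
    [set (j, d + 1 - j) | j in [set j | p + 1 <= j <= d - q]]
  else
    [set (j, d - j) | j in [set j | d - q <= j <= p]] `|`
    [set (j, d - 1 - j) | j in [set j | d - q <= j <= p - 1]].

Definition square_shape (S : set (int * int)) : Prop :=
  exists p q, S = square_pts p q.

Definition zigzag_shape (S : set (int * int)) : Prop :=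
  [\/ exists r p q, 1 <= r /\ S = even1_pts r p q,
      exists r p q, 1 <= r /\ S = even2_pts r p q
    | exists d p q, S = odd_pts d p q].

(* A shape is the subset of Z^2 itself, not the parameters describing it. *)
Definition dshape : Type :=
  {S : set (int * int) | square_shape S \/ zigzag_shape S}.

Definition has_shape (K : fieldType) (A : dcomplex K) (S : set (int * int)) :
    Prop :=
  [/\ forall a b, S (a, b) -> inhabited (Vector.axiom 1 (A a b)),
      forall a b, ~ S (a, b) -> forall x : A a b, x = 0,
      forall a b, S (a, b) -> S (a + 1, b) -> bijective (d1 A a b)
    & forall a b, S (a, b) -> S (a, b + 1) -> bijective (d2 A a b)].

Definition is_square (K : fieldType) (A : dcomplex K) : Prop :=
  exists2 S, square_shape S & has_shape A S.

Definition is_zigzag (K : fieldType) (A : dcomplex K) : Prop :=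
  exists2 S, zigzag_shape S & has_shape A S.

(* Cardinals are represented by types, with equality of cardinals being the   *)
(* existence of a bijection.                                                  *)
Definition same_card (M N : Type) : Prop := exists f : M -> N, bijective f.

Definition shape_sum (K : fieldType) (C : dshape -> dcomplex K)
    (m : dshape -> Type) : dcomplex K :=
  dcsum (fun S : dshape => dcsum (fun _ : m S => C S)).

Lemma zigzag_diag S : zigzag_shape S ->
  exists c : int, forall a b, S (a, b) -> a + b = c \/ a + b = c + 1.
Proof.
case=> [[r [p [q [_ ->]]]]|[r [p [q [_ ->]]]]|[d [p [q ->]]]].
- by exists (p + q) => a b /= [j [_ [] [-> ->]]]; lia.
- by exists (p + q) => a b /= [j [_ [] [-> ->]]]; lia.
- rewrite /odd_pts; case: ifP => _.
  + by exists d => a b /= [] [j _ [<- <-]]; lia.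
  + by exists (d - 1) => a b /= [] [j _ [<- <-]]; lia.
Qed.

Lemma square_cases p q a b : square_pts p q (a, b) <->
  (a = p \/ a = p - 1) /\ (b = q \/ b = q - 1).
Proof.
split=> [|[[-> | ->] [-> | ->]]]; rewrite /square_pts /=; last 4 first.
- by left; left; left.
- by left; right.
- by left; left; right.
- by right.
by move=> [[[]|]|] [-> ->]; split; by [left|right].
Qed.

(* For every shape a double complex of that shape exists: K at the points of  *)
(* S, d1 = 1 and d2 = (-1)^a whenever source and target both lie in S.        *)
Section Model.
Variables (K : fieldType) (S : dshape).

Let n (a b : int) : nat := `[< sval S (a, b) >].
Let V a b : lmodType K := 'rV[K]_(n a b).
Let sg (a : int) : K := (-1) ^+ `|a|%N.
Let e1 a b : {linear V a b -> V (a + 1) b} := mulmxr (const_mx 1).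
Let e2 a b : {linear V a b -> V a (b + 1)} := mulmxr (const_mx (sg a)).

Let sgS a : sg (a + 1) = - sg a.
Proof.
rewrite /sg -signr_odd -[in RHS]signr_odd.
have -> : odd (absz (a + 1)%R) = ~~ odd (absz a) by lia.
by case: (odd _); rewrite ?expr1 ?expr0 ?opprK.
Qed.

Let ord_S a b : 'I_(n a b) -> sval S (a, b).
Proof. by rewrite /n; case: asboolP => // _ []. Qed.

Let n1 a b : sval S (a, b) -> n a b = 1%N.
Proof. by rewrite /n => /asboolP ->. Qed.

Let mul_const m u v k l :
  (const_mx k : 'M_(m, u)) *m const_mx l = const_mx (k * l *+ u) :> 'M[K]_(m, v).
Proof.
apply/matrixP=> i j; rewrite !mxE.
under eq_bigr do rewrite !mxE.
by rewrite sumr_const card_ord.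
Qed.

Let n0 a b : ~ sval S (a, b) -> n a b = 0%N.
Proof. by rewrite /n; case: asboolP. Qed.

Let no3 a b : sval S (a, b) ->
  (sval S (a + 1 + 1, b) -> ~ sval S (a + 1, b)) /\
  (sval S (a, b + 1 + 1) -> ~ sval S (a, b + 1)).
Proof.
case: S => T /= [[p [q ->]]|/zigzag_diag[c Hc]].
  by rewrite !square_cases; lia.
by move=> /Hc ?; split=> /Hc ? /Hc ?; lia.
Qed.

Let diag2 a b : sval S (a, b) -> sval S (a + 1, b + 1) ->
  sval S (a, b + 1) /\ sval S (a + 1, b).
Proof.
case: S => T /= [[p [q ->]]|/zigzag_diag[c Hc]].
  by rewrite !square_cases; lia.
by move=> /Hc ? /Hc ?; lia.
Qed.

Let e1e1 a b x : e1 (a + 1) b (e1 a b x) = 0.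
Proof.
rewrite /e1 /= -mulmxA mul_const; set M := const_mx _.
suff -> : M = 0 by rewrite mulmx0.
apply/matrixP=> i j; rewrite !mxE n0 ?mulr0n//.
exact: (no3 (ord_S i)).1 (ord_S j).
Qed.

Let e2e2 a b x : e2 a (b + 1) (e2 a b x) = 0.
Proof.
rewrite /e2 /= -mulmxA mul_const; set M := const_mx _.
suff -> : M = 0 by rewrite mulmx0.
apply/matrixP=> i j; rewrite !mxE n0 ?mulr0n//.
exact: (no3 (ord_S i)).2 (ord_S j).
Qed.

Let e1e2 a b x : e1 a (b + 1) (e2 a b x) + e2 (a + 1) b (e1 a b x) = 0.
Proof.
rewrite /e1 /e2 /= -!mulmxA !mul_const -mulmxDr; set M := (X in _ *m X).
suff -> : M = 0 by rewrite mulmx0.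
apply/matrixP=> i j; rewrite !mxE.
have [/n1 -> /n1 ->] := diag2 (ord_S i) (ord_S j).
by rewrite !mulr1n sgS mulr1 mul1r subrr.
Qed.

Definition model : dcomplex K := DComplex e1e1 e2e2 e1e2.

Let bij u v (k : K) : u = 1%N -> v = 1%N -> k != 0 ->
  bijective (fun x : 'rV_u => x *m (const_mx k : 'M_(u, v))).
Proof.
move=> -> -> k0.
exists (fun x => x *m (const_mx k^-1 : 'M_1)) => x;
  rewrite -mulmxA mul_const mulr1n ?mulfV ?mulVf //;
  apply/rowP => i; rewrite mxE big_ord1 mxE mulr1; congr (x _ _);
  by rewrite !ord1.
Qed.

Lemma model_shape : has_shape model (sval S).
Proof.
split=> /= [a b Sab|a b /n0 Sab|a b /n1 Sab /n1 Sab'|a b /n1 Sab /n1 Sab'].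
- constructor; rewrite /V (n1 Sab); exists id => //; by exists id.
- by rewrite /V Sab => x; rewrite thinmx0.
- by apply: bij => //; exact: oner_neq0.
- by apply: bij => //; rewrite expf_neq0// oppr_eq0 oner_eq0.
Qed.

End Model.

(* Main.v *)
Require Import Defs.
From mathcomp Require Import all_boot all_order all_algebra.
From HB Require Import structures.
From mathcomp Require Import boolp classical_sets functions cardinality fsbigop.
From mathcomp Require Import zify ring.

(* Call S-summand of A a pair C(S) -> A -> C(S) with nonzero composite.

   Peeling: evaluation at a point x0 of S maps Hom(C(S), A) to the colimit of A
   over S, i.e. the quotient of the sum of all A^{p,q} by the relations dual to
   the arrows of C(S). Homs whose images form a basis of the image of this map
   split off a sum of copies of C(S), because linear functionals on the colimit
   are exactly the morphisms A -> C(S); the complement has no S-summand.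

   A bounded A <> 0 has an S-summand for some S: a square if d1 d2 <> 0;
   otherwise a zigzag, found by walking to the right from the leftmost place of
   an antidiagonal that is not contained in im d1 + im d2. As only finitely many
   shapes fit into the support of A, peeling terminates with 0.

   Uniqueness: End(C(S)) = K, and C(S) -> C(S') -> C(S) vanishes for S <> S' as
   shapes are connected. So mutually inverse maps between two sums of shapes
   induce mutually inverse maps between their S-isotypic parts at any point of
   S, and the multiplicities agree by the exchange lemma and Cantor-Bernstein. *)

Set Implicit Arguments.
Unset Strict Implicit.
Unset Printing Implicit Defensive.

Import Order.TTheory GRing.Theory Num.Theory.
Local Open Scope classical_set_scope.
Local Open Scope ring_scope.

(** * Linear algebra in arbitrary dimension *)

(** Dimensions and multiplicities may be infinite, so complements, dual bases and comparisons of
    bases all rest on Zorn's lemma. Splitting off one copy at a time need not terminate; hence all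
    copies of one shape are removed at once. The functionals dual to a basis, taken separately,
    would only give a map from A to the product of the copies; to land in the direct sum, the
    coordinates are extended as a single linear map with values in a direct sum of lines. A summand
    of the complement is also a summand of A, so removing one shape never introduces another. The
    walk along an antidiagonal starts at its leftmost non-boundary place for this reason: a zigzag
    may begin with a target, and the other arrow into that target comes from one step further left,
    where everything is a boundary and is killed by d1 once d1 d2 = 0. *)

Lemma linear_exists (K : fieldType) (V W : lmodType K) (f : V -> W) :
  linear f -> exists h : {linear V -> W}, h =1 f.
Proof.
move=> fl; pose m := GRing.isLinear.Build K V W _ f fl.
by exists (HB.pack f m : {linear V -> W}).
Qed.

Section Span.
Variables (K : fieldType) (V : lmodType K).
Implicit Types (X Y Q : set V) (v w a : V).

Definition submodule Q :=
  Q 0 /\ forall k v w, Q v -> Q w -> Q (k *: v + w).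

(** An intersection of submodules instead of finite sums: induction over linear combinations becomes
    the choice of a submodule [Q]. *)
Definition lspan X : set V :=
  [set v | forall Q, submodule Q -> X `<=` Q -> Q v].

Lemma submodule_span X : submodule (lspan X).
Proof.
split=> [Q [Q0 _] _ //|k v w Xv Xw Q sQ XQ].
by apply: sQ.2; [exact: Xv|exact: Xw].
Qed.

Lemma sub_span X : X `<=` lspan X.
Proof. by move=> v Xv Q _; exact. Qed.

Lemma span_min X Q : submodule Q -> X `<=` Q -> lspan X `<=` Q.
Proof. by move=> sQ XQ v; exact. Qed.

Lemma spanS X Y : X `<=` Y -> lspan X `<=` lspan Y.
Proof.
by move=> XY; apply: span_min (submodule_span Y) _ => v /XY; exact: sub_span.
Qed.

Lemma submoduleZ Q k v : submodule Q -> Q v -> Q (k *: v).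
Proof. by move=> sQ Qv; rewrite -[k *: v]addr0; apply: sQ.2 => //; exact: sQ.1. Qed.

Lemma submoduleD Q v w : submodule Q -> Q v -> Q w -> Q (v + w).
Proof. by move=> sQ Qv Qw; rewrite -[v]scale1r; apply: sQ.2. Qed.

Lemma submoduleN Q v : submodule Q -> Q v -> Q (- v).
Proof. by rewrite -scaleN1r; exact: submoduleZ. Qed.

Lemma submoduleB Q v w : submodule Q -> Q v -> Q w -> Q (v - w).
Proof. by move=> sQ Qv Qw; apply: submoduleD => //; exact: submoduleN. Qed.

Lemma spanU1 X a v : lspan (X `|` [set a]) v -> exists k, lspan X (v - k *: a).
Proof.
have sX := submodule_span X.
apply: (span_min (Q := [set v | exists k, lspan X (v - k *: a)])) => [|w [Xw|->]].
- split=> [|k u w [i ui] [j wj]].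
    by exists 0; rewrite scale0r subr0; exact: sX.1.
  exists (k * i + j); rewrite scalerDl opprD addrACA -scalerA -scalerBr.
  exact: sX.2.
- by exists 0; rewrite scale0r subr0; exact: sub_span.
- by exists 1; rewrite scale1r subrr; exact: sX.1.
Qed.

(** Linear combinations are finite, so membership in a span is reached at some stage of a chain.
    Members of [X] are only required to lie in [Y B] eventually, because [Y] need not be monotone.
    This makes the union of a chain admissible in the Zorn arguments below. *)
Lemma span_chain (T : Type) (F : set (set T)) (Y : set T -> set V) X v :
  F !=set0 -> total_on F subset ->
  (forall w, X w -> exists2 A, F A & forall B, F B -> A `<=` B -> Y B w) ->
  lspan X v ->
  exists2 A, F A & forall B, F B -> A `<=` B -> lspan (Y B) v.
Proof.
move=> [A0 FA0] Ftot XY; pose Q w :=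
  exists2 A, F A & forall B, F B -> A `<=` B -> lspan (Y B) w.
apply: (span_min (Q := Q)) => [|w /XY[A FA AY]].
  split=> [|k u w [A FA Au] [B FB Bw]].
    by exists A0 => // B _ _; exact: (submodule_span _).1.
  have [AB|BA] := Ftot _ _ FA FB.
    exists B => // C FC BC; apply: (submodule_span _).2; last exact: Bw.
    by apply: Au => //; exact: subset_trans BC.
  exists A => // C FC AC; apply: (submodule_span _).2; first exact: Au.
  by apply: Bw => //; exact: subset_trans AC.
by exists A => // B FB AB; apply: sub_span; exact: AY.
Qed.

End Span.

Lemma Zorn_set (T : Type) (P : set (set T)) : P set0 ->
  (forall F : set (set T), F !=set0 -> F `<=` P -> total_on F subset ->
     P (\bigcup_(X in F) X)) ->
  exists2 A, P A & forall B, A `<=` B -> P B -> B `<=` A.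
Proof.
move=> P0 PU; have [F FP Ft|A [PA Amax]] := @Zorn_bigcup T P.
  have [->|/set0P F0] := eqVneq F set0; first by rewrite bigcup_set0.
  exact: PU.
exists A => // B AB PB; apply: contrapT => BA; exact: (Amax B) PB.
Qed.

(** A set of pairs spans the graph of a partial linear map exactly when its span contains no
    [(0, w)] with [w] nonzero. A maximal enlargement with this property is total, since at a vector
    outside the domain the value 0 could still be prescribed. *)
Lemma linear_extension (K : fieldType) (V W : lmodType K)
    (G : set (V * W)%type) :
  (forall w, lspan G (0, w) -> w = 0) ->
  exists h : {linear V -> W}, forall v w, G (v, w) -> h v = w.
Proof.
move=> G0.
pose P (A : set (V * W)%type) := forall w, lspan (G `|` A) (0, w) -> w = 0.
have [|F F0 FP Ft w|A PA Amax] := @Zorn_set _ P.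
- by move=> w; rewrite setU0; exact: G0.
- move=> /(span_chain (Y := setU G) F0 Ft)[x [Gx|[A FA Ax]]|A FA AP].
  + by have [A FA] := F0; exists A => // B _ _; left.
  + by exists A => // B _ AB; right; exact: AB.
  + by apply: (FP _ FA); exact: AP.
have sA := submodule_span (G `|` A).
have tot v : exists w, lspan (G `|` A) (v, w).
  apply: contrapT => Nv; have : P (A `|` [set (v, 0)]).
    move=> w; rewrite setUA => /spanU1[k].
    have -> : (0, w) - k *: (v, 0) = (- k *: v, w).
      congr pair => /=; first by rewrite sub0r scaleNr.
      by rewrite scaler0 subr0.
    have [->|k0] := eqVneq k 0; first by rewrite oppr0 scale0r; exact: PA.
    move=> /(submoduleZ (- k^-1) sA) Aw; exfalso; apply: Nv.
    exists (- k^-1 *: w); move: Aw; congr (lspan _ _); congr pair => /=.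
    by rewrite scalerA mulrNN mulVf// scale1r.
  move=> /(Amax _ (@subsetUl _ _ _))/(_ (v, 0)) Av.
  by apply: Nv; exists 0; apply: sub_span; right; apply: Av; right.
have [h hP] := choice tot.
have uniq v w : lspan (G `|` A) (v, w) -> h v = w.
  move=> vw; apply/eqP; rewrite -subr_eq0; apply/eqP/PA.
  by have := submoduleB sA (hP v) vw; rewrite /= -[_ - _]/(v - v, h v - w) subrr.
have hl : linear h by move=> k u v; apply: uniq; exact: (sA.2 k _ _ (hP u) (hP v)).
have [h' h'E] := linear_exists hl.
by exists h' => v w Gvw; rewrite h'E; apply: uniq; apply: sub_span; left.
Qed.

(** Indices rather than vectors are selected: later they are morphisms, and distinct morphisms may
    give the same vector. *)
Lemma basis_modulo (K : fieldType) (X : Type) (V : lmodType K) (b : X -> V)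
    (U : set V) :
  exists J : set X,
    (forall x, J x -> ~ lspan (U `|` b @` (J `\ x)) (b x)) /\
    (forall x, lspan (U `|` b @` J) (b x)).
Proof.
pose P (A : set X) := forall x, A x -> ~ lspan (U `|` b @` (A `\ x)) (b x).
have [//|F F0 FP Ft x [A FA Ax]|J PJ Jmax] := @Zorn_set X P.
  move=> /(span_chain (Y := fun A => U `|` b @` (A `\ x)) F0 Ft)[v|B FB BP].
    case=> [Uv|[y [[B FB By] yx] <-]]; first by exists A => // B _ _; left.
    by exists B => // C _ BC; right; exists y => //; split=> //; exact: BC.
  have [AB|BA] := Ft _ _ FA FB.
    by apply: (FP _ FB x) => //; [exact: AB|exact: BP].
  by apply: (FP _ FA x) => //; exact: BP.
exists J; split=> // x; apply: contrapT => Nx.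
have Jx : ~ J x by move=> Jx; apply: Nx; apply: sub_span; right; exists x.
have : P (J `|` [set x]).
  move=> y Jy.
  have [yx|yx] := pselect (y = x).
    rewrite yx; apply: contra_not Nx; apply: spanS; apply/setUS/image_subset.
    by move=> z [[]].
  have {Jy}Jy : J y by case: Jy.
  move=> Hy; have : lspan ((U `|` b @` (J `\ y)) `|` [set b x]) (b y).
    apply: spanS Hy => v [Uv|[z [[Jz|->] zy] <-]]; last by right.
      by left; left.
    by left; right; exists z.
  (* A zero coefficient contradicts the independence of [J] at [y]; a nonzero one allows solving for
     [b x]. *)
  move=> /spanU1[k]; have [->|k0] := eqVneq k 0.
    by rewrite scale0r subr0; exact: PJ.
  have sJ := submodule_span (U `|` b @` J).
  move=> Hk; apply: Nx.
  have -> : b x = k^-1 *: (b y - (b y - k *: b x)).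
    by rewrite subKr scalerA mulVf// scale1r.
  apply: (submoduleZ _ sJ); apply: (submoduleB sJ).
    by apply: sub_span; right; exists y.
  by apply: spanS Hk; apply/setUS/image_subset => z [].
by move=> /(Jmax _ (@subsetUl _ _ _))/(_ x) Jx'; apply: Jx; apply: Jx'; right.
Qed.

(** Exchange without finiteness: in a partial matching each matched [b j] is replaced by its [c k],
    subject to the family staying independent. A maximal such matching is total, and independence
    forces distinct partners. *)
Lemma independent_spanning_inj (K : fieldType) (V : lmodType K) (M N : Type)
    (b : M -> V) (c : N -> V) :
  (forall j, ~ lspan (b @` [set~ j]) (b j)) ->
  (forall v, lspan (range c) v) ->
  exists f : M -> N, injective f.
Proof.
move=> bfree cspan.
(* [val A j v] says that [v] currently stands at index [j]; [Y A j] collects the vectors at the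
   other indices. *)
pose val (A : set (M * N)) j v :=
  (exists2 k, A (j, k) & v = c k) \/ ((forall k, ~ A (j, k)) /\ v = b j).
pose Y (A : set (M * N)) j := [set v | exists2 i, i <> j & val A i v].
pose P A := (forall j k k', A (j, k) -> A (j, k') -> k = k') /\
  (forall j v, val A j v -> ~ lspan (Y A j) v).
have [|F F0 FP Ft|A [Afun Afree] Amax] := @Zorn_set _ P.
- split=> // j v [[k []]|[_ ->]]; apply: contra_not (bfree j); apply: spanS.
  by move=> w [i ij [[k []]|[_ ->]]]; exists i.
- split=> [j k k' [A FA Ajk] [B FB Bjk']|j v Fv].
    have [AB|BA] := Ft _ _ FA FB.
      by apply: (FP _ FB).1 Bjk'; exact: AB.
    by apply: (FP _ FA).1 Ajk _; exact: BA.
  (* An index unmatched in the union keeps [b i] throughout; a matched one shows its [c k] from the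
     stage of its match on. *)
  have valF i w : val (\bigcup_(X in F) X) i w ->
      exists2 A, F A & forall B, F B -> A `<=` B -> val B i w.
    case=> [[k [A FA Aik] ->]|[Ni ->]].
      by exists A => // B _ AB; left; exists k => //; exact: AB.
    have [A FA] := F0; exists A => // B FB _; right; split=> // k Bik.
    by apply: (Ni k); exists B.
  have [A FA Av] := valF _ _ Fv.
  move=> /(span_chain (Y := Y^~ j) F0 Ft)[w [i ij /valF[B FB Bw]]|B FB BP].
    by exists B => // C FC BC; exists i => //; exact: Bw.
  have [AB|BA] := Ft _ _ FA FB.
    by apply: (FP _ FB).2 (BP _ FB _) => //; exact: Av.
  by apply: (FP _ FA).2 (BP _ FA _) => //; exact: Av.
have tot j : exists k, A (j, k).
  apply: contrapT => Nj.
  have vj : val A j (b j) by right; split=> // k Ajk; apply: Nj; exists k.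
  (* If all [c k] were in the span of the other vectors, so would be [b j]. *)
  have [k ck] : exists k, ~ lspan (Y A j) (c k).
    apply: contrapT => Nk; apply: (Afree _ _ vj).
    apply: (span_min (submodule_span _) _ (cspan (b j))) => _ [k _ <-].
    by apply: contrapT => ck; apply: Nk; exists k.
  have val' i w : i <> j -> val (A `|` [set (j, k)]) i w -> val A i w.
    move=> ij [[k' [Aik'|[]]]|[Ni ->]] //; first by left; exists k'.
    by right; split=> // k' Aik'; apply: (Ni k'); left.
  have : P (A `|` [set (j, k)]).
    split=> [i k1 k2|i v vi].
      have [-> [A1|[->]] [A2|[->]]|ij] := pselect (i = j) => //; first exact: Afun A1 A2.
      - by case: Nj; exists k1.
      - by case: Nj; exists k2.
      - by move=> [A1|[/ij]] // [A2|[/ij]] //; exact: Afun A1 A2.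
    have [ij|ij] := pselect (i = j).
      have -> : v = c k.
        rewrite {}ij in vi; case: vi => [[k' [Ak'|[->]]]|[Nk]] //.
          by case: Nj; exists k'.
        by case: (Nk k); right.
      rewrite ij; apply: contra_not ck; apply: spanS => w [l lj /val' lw].
      by exists l => //; exact: lw.
    have {}vi := val' _ _ ij vi.
    pose Z := [set w | exists2 l, l <> i /\ l <> j & val A l w].
    move=> Yv; have : lspan (Z `|` [set c k]) v.
      apply: spanS Yv => w [l li lw].
      have [lj|lj] := pselect (l = j); last first.
        by left; exists l => //; exact: val' lw.
      right; rewrite lj in lw; case: lw => [[k' [Ak'|[->]]]|[Nk]] //.
        by case: Nj; exists k'.
      by case: (Nk k); right.
    move=> /spanU1[m]; have [->|m0] := eqVneq m 0.
      rewrite scale0r subr0 => Zv; apply: (Afree i v vi).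
      by apply: spanS Zv => w [l [li _] lw]; exists l.
    move=> Zv; apply: ck; have sY := submodule_span (Y A j).
    have -> : c k = m^-1 *: (v - (v - m *: c k)).
      by rewrite subKr scalerA mulVf// scale1r.
    apply: (submoduleZ _ sY); apply: (submoduleB sY).
      by apply: sub_span; exists i.
    by apply: spanS Zv => w [l [_ lj] lw]; exists l.
  move=> /(Amax _ (@subsetUl _ _ _))/(_ (j, k)) Ajk.
  by apply: Nj; exists k; apply: Ajk; right.
have [f fP] := choice tot; exists f => i j fij.
apply: contrapT => ij; apply: (Afree j (c (f j))); first by left; exists (f j).
by apply: sub_span; exists i => //; left; exists (f i) => //; rewrite fij.
Qed.

(** * Direct sums *)

Section DSumTheory.
Variables (K : fieldType) (I : Type) (V : I -> lmodType K).

Definition dsum_in_fun i (x : V i) : dprod V := fun j =>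
  if pselect (i = j) is left e then eq_rect i (fun k => V k : Type) x j e else 0.

Lemma dsum_in_funE i (x : V i) : dsum_in_fun x i = x.
Proof.
by rewrite /dsum_in_fun; case: pselect => // e; rewrite (Prop_irrelevance e erefl).
Qed.

Lemma dsum_in_fun_neq i j (x : V i) : i <> j -> dsum_in_fun x j = 0.
Proof. by rewrite /dsum_in_fun; case: pselect. Qed.

Lemma dsum_in_supp i (x : V i) : dsum_in_fun x \in @fin_supp K I V.
Proof.
apply/asboolP; apply: sub_finite_set (finite_set1 i) => j /= /eqP xj.
by apply: contrapT => ji; apply: xj; apply: dsum_in_fun_neq => /esym.
Qed.

Definition dsum_in_raw i (x : V i) : dsum V := DSum (dsum_in_supp x).

Lemma dsum_in_linear i : linear (@dsum_in_raw i).
Proof.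
move=> k x y; apply: dsumP => j /=.
have [<-|ij] := pselect (i = j).
  by rewrite dsum_in_funE; congr (k *: _ + _); rewrite dsum_in_funE.
rewrite dsum_in_fun_neq//.
change (0 = k *: dsum_in_fun x j + dsum_in_fun y j).
by rewrite !dsum_in_fun_neq// scaler0 addr0.
Qed.

HB.instance Definition _ i :=
  GRing.isLinear.Build K (V i) (dsum V) _ (@dsum_in_raw i) (@dsum_in_linear i).

Definition dsum_in i : {linear V i -> dsum V} :=
  locked (@dsum_in_raw i : {linear V i -> dsum V}).

Definition dsum_pr_raw i (f : dsum V) : V i := dsum_val f i.

Lemma dsum_pr_linear i : linear (@dsum_pr_raw i).
Proof. by []. Qed.

HB.instance Definition _ i :=
  GRing.isLinear.Build K (dsum V) (V i) _ (@dsum_pr_raw i) (@dsum_pr_linear i).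

Definition dsum_pr i : {linear dsum V -> V i} :=
  locked (@dsum_pr_raw i : {linear dsum V -> V i}).

Lemma dsum_prE i f : dsum_pr i f = dsum_val f i.
Proof. by rewrite /dsum_pr -lock. Qed.

Lemma dsum_prP (f g : dsum V) : (forall i, dsum_pr i f = dsum_pr i g) -> f = g.
Proof. by move=> fg; apply: dsumP => i; have := fg i; rewrite !dsum_prE. Qed.

Lemma dsum_prK i (x : V i) : dsum_pr i (dsum_in i x) = x.
Proof. by rewrite dsum_prE /dsum_in -lock; exact: dsum_in_funE. Qed.

Lemma dsum_pr_neq i j (x : V i) : i <> j -> dsum_pr j (dsum_in i x) = 0.
Proof. by rewrite dsum_prE /dsum_in -lock; exact: dsum_in_fun_neq. Qed.

Lemma dsum_supp (f : dsum V) : exists s : seq {classic I},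
  uniq s /\ forall i : {classic I}, dsum_pr i f != 0 -> i \in s.
Proof.
case: f => f ff; have /asboolP ff' := ff.
have [s sE] := (@finite_seqP {classic I} _).1 ff'.
exists (undup (s : seq {classic I})); rewrite undup_uniq; split=> // i fi.
rewrite mem_undup; have : [set i | f i != 0] i by move: fi; rewrite dsum_prE.
by rewrite sE.
Qed.

Lemma dsum_sum (f : dsum V) (s : seq {classic I}) :
  uniq s -> (forall i : {classic I}, dsum_pr i f != 0 -> i \in s) ->
  f = \sum_(i <- s) dsum_in i (dsum_pr i f).
Proof.
move=> us fs; apply: dsum_prP => j; rewrite linear_sum /=.
have [js|js] := boolP ((j : {classic I}) \in s).
  rewrite (bigD1_seq (j : {classic I}))//= dsum_prK big1 ?addr0// => i ij.
  by apply: dsum_pr_neq => ij'; rewrite ij' eqxx in ij.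
rewrite big1_seq; first by apply/eqP; apply: contraNT js; exact: fs.
move=> i /andP[_ si]; apply: dsum_pr_neq => ij.
by rewrite -ij si in js.
Qed.

Section Lift.
Variables (W : lmodType K) (h : forall i, {linear V i -> W}).

Definition dsum_lift_fun (f : dsum V) : W :=
  \sum_(i <- sval (cid (dsum_supp f))) h i (dsum_pr i f).

(** Any duplicate-free list containing the support gives the same sum, so several elements can be
    summed over one common list; linearity rests on this. *)
Lemma dsum_lift_funE (f : dsum V) (s : seq {classic I}) :
  uniq s -> (forall i : {classic I}, dsum_pr i f != 0 -> i \in s) ->
  dsum_lift_fun f = \sum_(i <- s) h i (dsum_pr i f).
Proof.
rewrite /dsum_lift_fun; case: cid => t /= [ut ft] us fs.
rewrite (bigID (fun i => dsum_pr i f != 0)) [RHS](bigID (fun i => dsum_pr i f != 0)).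
rewrite /= [X in _ + X]big1 => [|i /negbNE/eqP ->]; last by rewrite linear0.
rewrite [X in _ = _ + X]big1 => [|i /negbNE/eqP ->]; last by rewrite linear0.
rewrite !addr0 -big_filter -[RHS]big_filter; apply: (@perm_big _ _ _ {classic I}).
apply: uniq_perm; rewrite ?filter_uniq// => i; rewrite !mem_filter.
by case: eqP => //= /eqP fi; rewrite ft ?fs.
Qed.

Lemma dsum_lift_linear : linear dsum_lift_fun.
Proof.
move=> k f g; have [s [us fs]] := dsum_supp f; have [t [ut gt]] := dsum_supp g.
pose r := undup (s ++ t); have ur : uniq r by rewrite undup_uniq.
rewrite !(@dsum_lift_funE _ r)//.
- rewrite scaler_sumr -big_split; apply: eq_bigr => i _ /=.
  by rewrite linearD/= linearZ/= linearD/= linearZ.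
- by move=> i /gt ti; rewrite mem_undup mem_cat ti orbT.
- by move=> i /fs si; rewrite mem_undup mem_cat si.
move=> i; rewrite mem_undup mem_cat linearD linearZ /=; apply: contraR.
rewrite negb_or => /andP[/(contra (fs i)) si /(contra (gt i)) ti].
by move: si ti => /negbNE/eqP -> /negbNE/eqP ->; rewrite scaler0 addr0.
Qed.

HB.instance Definition _ :=
  GRing.isLinear.Build K (dsum V) W _ dsum_lift_fun dsum_lift_linear.

Definition dsum_lift : {linear dsum V -> W} :=
  locked (dsum_lift_fun : {linear dsum V -> W}).

Lemma dsum_liftE i (x : V i) : dsum_lift (dsum_in i x) = h i x.
Proof.
rewrite /dsum_lift -lock /= (@dsum_lift_funE _ [:: (i : {classic I})])//.
  by rewrite big_seq1 dsum_prK.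
move=> j; rewrite mem_seq1; apply: contraR => ji; apply/eqP/dsum_pr_neq => ij.
by rewrite ij eqxx in ji.
Qed.

End Lift.

Lemma dsum_eq_on (W : lmodType K) (h g : {linear dsum V -> W}) (f : dsum V) :
  (forall i, h (dsum_in i (dsum_pr i f)) = g (dsum_in i (dsum_pr i f))) ->
  h f = g f.
Proof.
move=> hg; have [s [us fs]] := dsum_supp f.
by rewrite (dsum_sum us fs) !linear_sum; apply: eq_bigr => i _; exact: hg.
Qed.

Lemma dsum_eq0 (W : lmodType K) (h : {linear dsum V -> W}) (f : dsum V) :
  (forall i, h (dsum_in i (dsum_pr i f)) = 0) -> h f = 0.
Proof.
move=> h0; have [s [us fs]] := dsum_supp f.
by rewrite (dsum_sum us fs) linear_sum big1.
Qed.

Lemma dsum_ext (W : lmodType K) (h g : {linear dsum V -> W}) :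
  (forall i x, h (dsum_in i x) = g (dsum_in i x)) -> h =1 g.
Proof. by move=> hg f; exact: dsum_eq_on. Qed.

Lemma dsum_ind (Q : set (dsum V)) : submodule Q ->
  (forall i x, Q (dsum_in i x)) -> forall f, Q f.
Proof.
move=> sQ Qin f; have [s [us fs]] := dsum_supp f; rewrite (dsum_sum us fs).
elim/big_ind: _ => [|? ? ? ?|i _]; [exact: sQ.1|exact: submoduleD|exact: Qin].
Qed.

End DSumTheory.

Arguments dsum_in {K I} V i.
Arguments dsum_pr {K I} V i.
Arguments dsum_lift {K I V W} h.

Lemma dsum_mapE (K : fieldType) (I : Type) (V W : I -> lmodType K)
    (h : forall i, {linear V i -> W i}) i f :
  dsum_pr W i (dsum_map h f) = h i (dsum_pr V i f).
Proof. by rewrite !dsum_prE. Qed.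

Lemma dsum_map_in (K : fieldType) (I : Type) (V W : I -> lmodType K)
    (h : forall i, {linear V i -> W i}) i x :
  dsum_map h (dsum_in V i x) = dsum_in W i (h i x).
Proof.
apply: dsum_prP => j; rewrite dsum_mapE.
have [<-|ij] := pselect (i = j); first by rewrite !dsum_prK.
by rewrite !dsum_pr_neq// linear0.
Qed.

(** * Shapes *)

Section Shapes.

Definition adjacent (a b a' b' : int) : Prop :=
  (a' = a + 1 /\ b' = b) \/ (a' = a /\ b' = b + 1).

(** A walk through all points of [S] along arrows in either direction. It treats all families of
    shapes alike and makes connectedness an induction on the length. *)
Definition is_path (S : set (int * int)) (n : nat) (f g : nat -> int) : Prop :=
  (forall a b, S (a, b) <-> exists2 k, (k <= n)%N & a = f k /\ b = g k) /\
  (forall k, (k < n)%N -> adjacent (f k) (g k) (f k.+1) (g k.+1) \/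
                          adjacent (f k.+1) (g k.+1) (f k) (g k)).

Lemma square_path p q : exists n f g, is_path (square_pts p q) n f g.
Proof.
(* Three sides of the square already visit all corners. *)
exists 3%N, (fun k => if (k == 1)%N || (k == 2)%N then p else p - 1).
exists (fun k => if (k <= 1)%N then q - 1 else q).
split=> [a b|[|[|[|]]]]//=; last by rewrite /adjacent; lia.
- rewrite square_cases; split; last by move=> [[|[|[|[|k]]]]] //=; lia.
  move=> [[-> | ->] [-> | ->]].
  + by exists 2%N.
  + by exists 1%N.
  + by exists 3%N.
  + by exists 0%N.
- by rewrite /adjacent; lia.
- by rewrite /adjacent; lia.
Qed.

Lemma zigzag_path S : zigzag_shape S -> exists n f g, is_path S n f g.
Proof.
case=> [[r [p [q [r1 ->]]]]|[r [p [q [r1 ->]]]]|[d [p [q ->]]]].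
(* Two points for each of the [r] indices, hence [2 r - 1] steps; the halves rounded up and down
   advance the coordinates alternately. *)
- exists (absz (r)%R).*2.-1%N, (fun k => p + (uphalf k)%:Z), (fun k => q - (k./2)%:Z).
  split=> [a b|k _]; last by rewrite /adjacent /=; lia.
  split=> [[j [rj [] [-> ->]]]|[k kr [-> ->]]].
  + by exists `|j|.*2%N; lia.
  + by exists `|j|.*2.+1%N; lia.
  + exists (k./2)%:Z; split; first lia.
    by have [ok|ok] := boolP (odd k); [right|left]; congr pair; lia.
- exists (absz (r)%R).*2.-1%N, (fun k => p - (k./2)%:Z), (fun k => q + (uphalf k)%:Z).
  split=> [a b|k _]; last by rewrite /adjacent /=; lia.
  split=> [[j [rj [] [-> ->]]]|[k kr [-> ->]]].
  + by exists `|j|.*2%N; lia.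
  + by exists `|j|.*2.+1%N; lia.
  + exists (k./2)%:Z; split; first lia.
    by have [ok|ok] := boolP (odd k); [right|left]; congr pair; lia.
- rewrite /odd_pts; case: ifPn => pqd.
  + exists (absz (d - q - p)%R).*2%N, (fun k => p + (uphalf k)%:Z).
    exists (fun k => d - p - (k./2)%:Z).
    split=> [a b|k _]; last by rewrite /adjacent /=; lia.
    split=> [[] [j /= pj [<- <-]]|[k kr [-> ->]]].
    * by exists (absz (j - p)%R).*2%N; lia.
    * by exists (absz (j - p)%R).*2.-1%N; lia.
    * have [ok|ok] := boolP (odd k); [right|left]; exists (p + (uphalf k)%:Z) => /=;
        first [lia|congr pair; lia].
  + exists (absz (p - (d - q))%R).*2%N, (fun k => d - q + (k./2)%:Z).
    exists (fun k => q - (uphalf k)%:Z).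
    split=> [a b|k _]; last by rewrite /adjacent /=; lia.
    split=> [[] [j /= pj [<- <-]]|[k kr [-> ->]]].
    * by exists (absz (j - (d - q))%R).*2%N; lia.
    * by exists (absz (j - (d - q))%R).*2.+1%N; lia.
    * have [ok|ok] := boolP (odd k); [right|left]; exists (d - q + (k./2)%:Z) => /=;
        first [lia|congr pair; lia].
Qed.

Lemma dshape_path (S : dshape) : exists n f g, is_path (sval S) n f g.
Proof. by case: S => S /= [[p [q ->]]|/zigzag_path//]; exact: square_path. Qed.

Lemma dshape_eq (S S' : dshape) : sval S = sval S' -> S = S'.
Proof.
by case: S S' => [S p] [S' p'] /= SS'; subst; congr exist; exact: Prop_irrelevance.
Qed.

Lemma dshape_inhabited (S : dshape) : exists a b, sval S (a, b).
Proof.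
have [n [f [g [Sfg _]]]] := dshape_path S.
by exists (f 0%N), (g 0%N); apply/Sfg; exists 0%N.
Qed.

(** Used to carry an equality of scalars, or an identity known at a base point, across invertible
    arrows to all of [S]. *)
Lemma dshape_connected (S : dshape) (P : int -> int -> Prop) :
  (forall a b, sval S (a, b) -> sval S (a + 1, b) -> (P a b <-> P (a + 1) b)) ->
  (forall a b, sval S (a, b) -> sval S (a, b + 1) -> (P a b <-> P a (b + 1))) ->
  forall a b a' b', sval S (a, b) -> sval S (a', b') -> P a b -> P a' b'.
Proof.
move=> P1 P2; have [n [f [g [Sfg fg]]]] := dshape_path S.
have Sk k : (k <= n)%N -> sval S (f k, g k) by move=> kn; apply/Sfg; exists k.
have step k : (k < n)%N -> P (f k) (g k) <-> P (f k.+1) (g k.+1).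
  move=> kn; have := Sk _ kn; have := Sk _ (ltnW kn).
  by case: (fg k kn) => -[[-> ->]|[-> ->]] S1 S2; by [exact: P1|exact: P2|
    apply: iff_sym; exact: P1|apply: iff_sym; exact: P2].
have P0 k : (k <= n)%N -> P (f 0%N) (g 0%N) <-> P (f k) (g k).
  elim: k => // k IH kn; rewrite IH; last exact: ltnW.
  exact: step.
move=> a b a' b' /Sfg[k kn [-> ->]] /Sfg[l ln [-> ->]] Pk.
by apply/(P0 l ln)/(P0 k kn).
Qed.

End Shapes.

(** * Morphisms of double complexes *)

Lemma bijective_disomorphic (K : fieldType) (A B : dcomplex K)
    (f : dmorphism A B) : (forall p q, bijective (f p q)) -> disomorphic A B.
Proof.
move=> fbij.
have inv p q : exists g : {linear B p q -> A p q},
    cancel (f p q) g /\ cancel g (f p q).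
  have [g fK gK] := fbij p q.
  have gl : linear g by move=> k x y; rewrite -{1}[x]gK -{1}[y]gK -linearP fK.
  by have [h hE] := linear_exists gl; exists h; split=> x; rewrite hE.
pose g p q := sval (cid (inv p q)).
have gK p q : cancel (f p q) (g p q) /\ cancel (g p q) (f p q).
  exact: (svalP (cid (inv p q))).
have g1 p q x : g (p + 1) q (d1 B p q x) = d1 A p q (g p q x).
  by rewrite -{1}[x](gK p q).2 -dmap_d1 (gK _ _).1.
have g2 p q x : g p (q + 1) (d2 B p q x) = d2 A p q (g p q x).
  by rewrite -{1}[x](gK p q).2 -dmap_d2 (gK _ _).1.
by exists f, (DMorphism g1 g2) => p q; split=> x; rewrite ?(gK p q).1 ?(gK p q).2.
Qed.

Section Morphisms.
Variable K : fieldType.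
Implicit Types A B D : dcomplex K.

Section Comp.
Variables (A B D : dcomplex K) (f : dmorphism A B) (g : dmorphism B D).

Let h p q : {linear A p q -> D p q} := g p q \o f p q.
Let h1 p q x : h (p + 1) q (d1 A p q x) = d1 D p q (h p q x).
Proof. by rewrite /h /= !dmap_d1. Qed.
Let h2 p q x : h p (q + 1) (d2 A p q x) = d2 D p q (h p q x).
Proof. by rewrite /h /= !dmap_d2. Qed.

Definition dcompose : dmorphism A D := DMorphism h1 h2.

Lemma dcomposeE p q x : dcompose p q x = g p q (f p q x).
Proof. by []. Qed.
End Comp.

Section Sum.
Variables (I : Type) (B : I -> dcomplex K).

Let V p q i : lmodType K := B i p q.

Lemma dcsum_d1 p q x i :
  dsum_pr (V (p + 1) q) i (d1 (dcsum B) p q x) = d1 (B i) p q (dsum_pr (V p q) i x).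
Proof. exact: dsum_mapE. Qed.

Lemma dcsum_d2 p q x i :
  dsum_pr (V p (q + 1)) i (d2 (dcsum B) p q x) = d2 (B i) p q (dsum_pr (V p q) i x).
Proof. exact: dsum_mapE. Qed.

Let in1 i p q x :
  dsum_in (V (p + 1) q) i (d1 (B i) p q x) = d1 (dcsum B) p q (dsum_in (V p q) i x).
Proof. by rewrite [RHS]dsum_map_in. Qed.
Let in2 i p q x :
  dsum_in (V p (q + 1)) i (d2 (B i) p q x) = d2 (dcsum B) p q (dsum_in (V p q) i x).
Proof. by rewrite [RHS]dsum_map_in. Qed.

Definition dcsum_in i : dmorphism (B i) (dcsum B) := 
  @DMorphism K (B i) (dcsum B) (fun p q => dsum_in (V p q) i) (@in1 i) (@in2 i).

Let pr1 i p q x : dsum_pr (V (p + 1) q) i (d1 (dcsum B) p q x) =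
  d1 (B i) p q (dsum_pr (V p q) i x).
Proof. exact: dcsum_d1. Qed.
Let pr2 i p q x : dsum_pr (V p (q + 1)) i (d2 (dcsum B) p q x) =
  d2 (B i) p q (dsum_pr (V p q) i x).
Proof. exact: dcsum_d2. Qed.

Definition dcsum_pr i : dmorphism (dcsum B) (B i) := 
  @DMorphism K (dcsum B) (B i) (fun p q => dsum_pr (V p q) i) (@pr1 i) (@pr2 i).

Variables (A : dcomplex K) (h : forall i, dmorphism (B i) A).

Let l p q : {linear dcsum B p q -> A p q} := dsum_lift (fun i => h i p q).

Let l1 p q x : l (p + 1) q (d1 (dcsum B) p q x) = d1 A p q (l p q x).
Proof.
apply: (dsum_ext (h := l (p + 1) q \o d1 (dcsum B) p q) (g := d1 A p q \o l p q)).
move=> i y.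
by rewrite /= [dsum_map _ _](dsum_map_in (fun i => d1 (B i) p q)) !dsum_liftE dmap_d1.
Qed.
Let l2 p q x : l p (q + 1) (d2 (dcsum B) p q x) = d2 A p q (l p q x).
Proof.
apply: (dsum_ext (h := l p (q + 1) \o d2 (dcsum B) p q) (g := d2 A p q \o l p q)).
move=> i y.
by rewrite /= [dsum_map _ _](dsum_map_in (fun i => d2 (B i) p q)) !dsum_liftE dmap_d2.
Qed.

Definition dcsum_lift : dmorphism (dcsum B) A := DMorphism l1 l2.

End Sum.

(** * Kernels and the complement of a split summand *)

Section Kernel.
Variables (A B : dcomplex K) (f : dmorphism A B).

Section KernelAt.
Variables p q : int.

Definition kernel_pred : {pred A p q} := fun x => f p q x == 0.

Lemma kernel_submod_closed : submod_closed kernel_pred.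
Proof.
split=> [|k x y]; rewrite !unfold_in ?linear0// linearP => /eqP -> /eqP ->.
by rewrite scaler0 addr0.
Qed.

HB.instance Definition _ :=
  GRing.isSubmodClosed.Build K (A p q) kernel_pred kernel_submod_closed.

Record kernel : Type := Kernel { kernel_val : A p q; _ : kernel_val \in kernel_pred }.

HB.instance Definition _ := [isSub for kernel_val].
HB.instance Definition _ := [Choice of kernel by <:].
HB.instance Definition _ := [SubChoice_isSubLmodule of kernel by <:].

Lemma kernelP (x : kernel) : f p q (kernel_val x) = 0.
Proof. by case: x => x xP; apply/eqP. Qed.
End KernelAt.

Lemma kernel_d1_subproof p q (x : kernel p q) :
  d1 A p q (kernel_val x) \in @kernel_pred (p + 1) q.
Proof. by rewrite unfold_in dmap_d1 kernelP linear0. Qed.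
Lemma kernel_d2_subproof p q (x : kernel p q) :
  d2 A p q (kernel_val x) \in @kernel_pred p (q + 1).
Proof. by rewrite unfold_in dmap_d2 kernelP linear0. Qed.

Definition kernel_d1_fun p q (x : kernel p q) := Kernel (kernel_d1_subproof x).
Definition kernel_d2_fun p q (x : kernel p q) := Kernel (kernel_d2_subproof x).

Lemma kernel_d1_linear p q : linear (@kernel_d1_fun p q).
Proof. by move=> k x y; apply: val_inj; rewrite /= linearP. Qed.
Lemma kernel_d2_linear p q : linear (@kernel_d2_fun p q).
Proof. by move=> k x y; apply: val_inj; rewrite /= linearP. Qed.

HB.instance Definition _ p q := GRing.isLinear.Build K (kernel p q)
  (kernel (p + 1) q) _ (@kernel_d1_fun p q) (@kernel_d1_linear p q).
HB.instance Definition _ p q := GRing.isLinear.Build K (kernel p q)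
  (kernel p (q + 1)) _ (@kernel_d2_fun p q) (@kernel_d2_linear p q).

Let e1 p q : {linear kernel p q -> kernel (p + 1) q} := @kernel_d1_fun p q.
Let e2 p q : {linear kernel p q -> kernel p (q + 1)} := @kernel_d2_fun p q.

Let e1e1 p q x : e1 (p + 1) q (e1 p q x) = 0.
Proof. by apply: val_inj; exact: d1d1. Qed.
Let e2e2 p q x : e2 p (q + 1) (e2 p q x) = 0.
Proof. by apply: val_inj; exact: d2d2. Qed.
Let e1e2 p q x : e1 p (q + 1) (e2 p q x) + e2 (p + 1) q (e1 p q x) = 0.
Proof. by apply: val_inj; exact: d1d2. Qed.

Definition dkernel : dcomplex K :=
  @DComplex K (fun p q => kernel p q : lmodType K) e1 e2 e1e1 e2e2 e1e2.

Let i0 p q : {linear dkernel p q -> A p q} := \val.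
Let i1 p q x : i0 (p + 1) q (d1 dkernel p q x) = d1 A p q (i0 p q x).
Proof. by []. Qed.
Let i2 p q x : i0 p (q + 1) (d2 dkernel p q x) = d2 A p q (i0 p q x).
Proof. by []. Qed.

Definition dkernel_in : dmorphism dkernel A := DMorphism i1 i2.

Lemma dkernel_in_inj p q : injective (dkernel_in p q).
Proof. exact: val_inj. Qed.

Lemma dkernel_inP p q x : f p q (dkernel_in p q x) = 0.
Proof. exact: kernelP. Qed.

Section Retraction.
Variable s : dmorphism B A.
Hypothesis fs : forall p q x, f p q (s p q x) = x.

Lemma dkernel_pr_subproof p q (x : A p q) :
  x - s p q (f p q x) \in @kernel_pred p q.
Proof. by rewrite unfold_in linearB /= fs subrr. Qed.

Definition dkernel_pr_fun p q (x : A p q) : dkernel p q :=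
  Kernel (dkernel_pr_subproof x).

Lemma dkernel_pr_linear p q : linear (@dkernel_pr_fun p q).
Proof.
by move=> k x y; apply: val_inj; rewrite /= !linearP /= addrACA -scalerDr.
Qed.

HB.instance Definition _ p q := GRing.isLinear.Build K (A p q)
  (dkernel p q) _ (@dkernel_pr_fun p q) (@dkernel_pr_linear p q).

Let r0 p q : {linear A p q -> dkernel p q} := @dkernel_pr_fun p q.
Let r1 p q x : r0 (p + 1) q (d1 A p q x) = d1 dkernel p q (r0 p q x).
Proof. by apply: val_inj; rewrite /= !dmap_d1 linearB. Qed.
Let r2 p q x : r0 p (q + 1) (d2 A p q x) = d2 dkernel p q (r0 p q x).
Proof. by apply: val_inj; rewrite /= !dmap_d2 linearB. Qed.

Definition dkernel_pr : dmorphism A dkernel := DMorphism r1 r2.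

Lemma dkernel_prE p q x :
  dkernel_in p q (dkernel_pr p q x) = x - s p q (f p q x).
Proof. by []. Qed.

Lemma dkernel_prK p q x : dkernel_pr p q (dkernel_in p q x) = x.
Proof.
by apply: dkernel_in_inj; rewrite dkernel_prE dkernel_inP linear0 subr0.
Qed.
End Retraction.
End Kernel.
End Morphisms.

(** * Uniqueness of multiplicities *)

Section Frame.
Variables (K : fieldType) (B : dcomplex K) (S : set (int * int)).

(* [fl] and [fm] are the matrix entries of d1 and d2 in the basis [fvec]. *)
Record frame := Frame {
  fvec : forall a b, B a b;
  fcoord : forall a b, {linear B a b -> K^o};
  fl : int -> int -> K;
  fm : int -> int -> K;
  fvecE : forall a b y, y = (fcoord a b y : K) *: fvec a b;
  fcoordK : forall a b, S (a, b) -> fcoord a b (fvec a b) = 1;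
  fvec_d1 : forall a b, d1 B a b (fvec a b) = fl a b *: fvec (a + 1) b;
  fvec_d2 : forall a b, d2 B a b (fvec a b) = fm a b *: fvec a (b + 1);
  fl_neq0 : forall a b, S (a, b) -> S (a + 1, b) -> fl a b != 0;
  fm_neq0 : forall a b, S (a, b) -> S (a, b + 1) -> fm a b != 0;
  fl0 : forall a b, ~ (S (a, b) /\ S (a + 1, b)) -> fl a b = 0;
  fm0 : forall a b, ~ (S (a, b) /\ S (a, b + 1)) -> fm a b = 0
}.

Hypothesis BS : has_shape B S.

Lemma frame_at a b : exists ck : B a b * {linear B a b -> K^o},
  (forall y, y = (ck.2 y : K) *: ck.1) /\ (S (a, b) -> ck.2 ck.1 = 1).
Proof.
have [B1 B0 _ _] := BS.
have [Sab|Sab] := pselect (S (a, b)); last first.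
  (* Outside [S] the component is zero, so zero data satisfy the first property, which is demanded
     at every bidegree. *)
  by exists (0, (\0 : {linear B a b -> K^o})); split=> // y; rewrite scaler0; exact: B0 Sab y.
have [[r rl [r' rK r'K]]] := B1 _ _ Sab.
pose k y : K^o := r y 0 0.
have kl : linear k by move=> t x y; rewrite /k rl !mxE.
have [k' k'E] := linear_exists kl.
pose o : 'rV[K]_1 := const_mx 1.
exists (r' o, k'); split=> [y|_] /=; last by rewrite k'E /k r'K mxE.
apply: (can_inj rK).
have -> : r (k' y *: r' o) = k' y *: r (r' o).
  by have [r2 r2E] := linear_exists rl; rewrite -!r2E linearZ.
rewrite r'K k'E; apply/rowP => i; rewrite !mxE mulr1 /k.
by rewrite !ord1.
Qed.

Lemma frame_exists : inhabited frame.
Proof.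
have [B1 B0 bij1 bij2] := BS.
pose ck a b := cid (frame_at a b).
pose c a b := (sval (ck a b)).1; pose k a b := (sval (ck a b)).2.
have cE a b y : y = (k a b y : K) *: c a b by exact: (svalP (ck a b)).1.
have kc a b : S (a, b) -> k a b (c a b) = 1 by exact: (svalP (ck a b)).2.
pose l a b : K :=
  if pselect (S (a, b) /\ S (a + 1, b)) then k (a + 1) b (d1 B a b (c a b)) else 0.
pose m a b : K :=
  if pselect (S (a, b) /\ S (a, b + 1)) then k a (b + 1) (d2 B a b (c a b)) else 0.
have c0 a b : S (a, b) -> c a b <> 0.
  by move=> Sab cab; have /eqP := kc _ _ Sab; rewrite cab linear0 eq_sym oner_eq0.
constructor; apply: (@Frame c k l m) => // a b.
- rewrite /l; case: (pselect (S (a, b) /\ S (a + 1, b))) => [?|nS] /=; first exact: cE.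
  rewrite scale0r; have [Sab|Sab] := pselect (S (a, b)).
    by apply: B0 => Sa1; apply: nS.
  by rewrite (B0 _ _ Sab (c a b)) linear0.
- rewrite /m; case: (pselect (S (a, b) /\ S (a, b + 1))) => [?|nS] /=; first exact: cE.
  rewrite scale0r; have [Sab|Sab] := pselect (S (a, b)).
    by apply: B0 => Sa1; apply: nS.
  by rewrite (B0 _ _ Sab (c a b)) linear0.
- move=> Sab Sab'; rewrite /l;
  case: (pselect (S (a, b) /\ S (a + 1, b))) => [?|[]//] /=.
  apply/eqP => k0.
  apply: (c0 _ _ Sab); apply: (bij_inj (bij1 _ _ Sab Sab')).
  by rewrite linear0 [LHS]cE k0 scale0r.
- move=> Sab Sab'; rewrite /m;
  case: (pselect (S (a, b) /\ S (a, b + 1))) => [?|[]//] /=.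
  apply/eqP => k0.
  apply: (c0 _ _ Sab); apply: (bij_inj (bij2 _ _ Sab Sab')).
  by rewrite linear0 [LHS]cE k0 scale0r.
- by move=> nS; rewrite /l; case: (pselect _).
- by move=> nS; rewrite /m; case: (pselect _).
Qed.

End Frame.

Section FrameTheory.
Variables (K : fieldType) (B : dcomplex K) (S : set (int * int)) (F : frame B S).
Variable A : dcomplex K.

Lemma fvec_neq0 a b : S (a, b) -> fvec F a b <> 0.
Proof.
move=> Sab c0; have := fcoordK F Sab.
by rewrite c0 linear0 => /eqP; rewrite eq_sym oner_eq0.
Qed.

Lemma fcoord_d1 a b y : fcoord F (a + 1) b (d1 B a b y) = fl F a b * fcoord F a b y.
Proof.
rewrite [in LHS](fvecE F y) linearZ /= fvec_d1 scalerA linearZ /=.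
rewrite mulrC -[_ *: _]/(_ * _).
have [[Sa Sb]|nS] := pselect (S (a, b) /\ S (a + 1, b)).
  by rewrite fcoordK// mulr1.
by rewrite fl0// !mul0r.
Qed.

Lemma fcoord_d2 a b y : fcoord F a (b + 1) (d2 B a b y) = fm F a b * fcoord F a b y.
Proof.
rewrite [in LHS](fvecE F y) linearZ /= fvec_d2 scalerA linearZ /=.
rewrite mulrC -[_ *: _]/(_ * _).
have [[Sa Sb]|nS] := pselect (S (a, b) /\ S (a, b + 1)).
  by rewrite fcoordK// mulr1.
by rewrite fm0// !mul0r.
Qed.

Lemma eq_notin a b (x y : B a b) : has_shape B S -> ~ S (a, b) -> x = y.
Proof. by move=> [_ B0 _ _] nS; rewrite (B0 _ _ nS x) (B0 _ _ nS y). Qed.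

Lemma fcoord_notin a b y : ~ S (a, b) -> has_shape B S -> fcoord F a b y = 0.
Proof. by move=> Sab [_ B0 _ _]; rewrite (B0 _ _ Sab y) linear0. Qed.

(** The [v a b] are the images of the basis vectors. Conditions at sources in [S] suffice; an arrow
    leaving [S] has entry 0, so there they say that the differential kills [v]. *)
Lemma frame_hom_from (v : forall a b, A a b) : has_shape B S ->
  (forall a b, S (a, b) -> d1 A a b (v a b) = fl F a b *: v (a + 1) b) ->
  (forall a b, S (a, b) -> d2 A a b (v a b) = fm F a b *: v a (b + 1)) ->
  exists f : dmorphism B A, forall a b y, f a b y = (fcoord F a b y : K) *: v a b.
Proof.
move=> BS v1 v2.
pose g a b (y : B a b) : A a b := (fcoord F a b y : K) *: v a b.
have gl a b : linear (g a b).
  by move=> k x y; rewrite /g linearP scalerDl /= scalerA.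
pose h a b := cid (linear_exists (gl a b)).
have hE a b y : sval (h a b) y = (fcoord F a b y : K) *: v a b by exact: (svalP (h a b)).
have h1 a b y : sval (h (a + 1) b) (d1 B a b y) = d1 A a b (sval (h a b) y).
  rewrite !hE fcoord_d1 linearZ /=.
  have [Sab|Sab] := pselect (S (a, b)); first by rewrite v1// scalerA mulrC.
  by rewrite fcoord_notin// mulr0 !scale0r.
have h2 a b y : sval (h a (b + 1)) (d2 B a b y) = d2 A a b (sval (h a b) y).
  rewrite !hE fcoord_d2 linearZ /=.
  have [Sab|Sab] := pselect (S (a, b)); first by rewrite v2// scalerA mulrC.
  by rewrite fcoord_notin// mulr0 !scale0r.
by exists (DMorphism h1 h2).
Qed.

(** Dual to [frame_hom_from]: conditions at targets in [S] suffice, and an arrow entering [S] from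
    outside has entry 0, so [u] must vanish on its image. *)
Lemma frame_hom_to (u : forall a b, {linear A a b -> K^o}) : has_shape B S ->
  (forall a b y, S (a + 1, b) -> u (a + 1) b (d1 A a b y) = fl F a b * u a b y) ->
  (forall a b y, S (a, b + 1) -> u a (b + 1) (d2 A a b y) = fm F a b * u a b y) ->
  exists f : dmorphism A B, forall a b y, f a b y = (u a b y : K) *: fvec F a b.
Proof.
move=> BS u1 u2; have [_ B0 _ _] := BS.
pose g a b (y : A a b) : B a b := (u a b y : K) *: fvec F a b.
have gl a b : linear (g a b).
  by move=> k x y; rewrite /g linearP scalerDl /= scalerA.
pose h a b := cid (linear_exists (gl a b)).
have hE a b y : sval (h a b) y = (u a b y : K) *: fvec F a b by exact: (svalP (h a b)).
have h1 a b y : sval (h (a + 1) b) (d1 A a b y) = d1 B a b (sval (h a b) y).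
  have [Sab|Sab] := pselect (S (a + 1, b)); last exact: (eq_notin _ _ BS Sab).
  by rewrite !hE linearZ /= fvec_d1 u1// scalerA mulrC.
have h2 a b y : sval (h a (b + 1)) (d2 A a b y) = d2 B a b (sval (h a b) y).
  have [Sab|Sab] := pselect (S (a, b + 1)); last exact: (eq_notin _ _ BS Sab).
  by rewrite !hE linearZ /= fvec_d2 u2// scalerA mulrC.
by exists (DMorphism h1 h2).
Qed.

End FrameTheory.

Arguments fvec_neq0 {K B S} F {a b} _ _.

(** * Maps between shapes and comparison of multiplicities *)

Section Uniqueness.
Variables (K : fieldType) (C : dshape -> dcomplex K).
Hypothesis hC : forall S : dshape, has_shape (C S) (sval S).

Lemma dshape_frame S : inhabited (frame (C S) (sval S)).
Proof. exact: frame_exists. Qed.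

(** Each component is a scalar because it is at most one-dimensional; commuting with a nonzero arrow
    equates the scalars at its two ends. *)
Lemma dshape_endo S (h : dmorphism (C S) (C S)) :
  exists k : K, forall a b y, h a b y = k *: y.
Proof.
have [F] := dshape_frame S; have [_ C0 _ _] := hC S.
have [a0 [b0 S0]] := dshape_inhabited S.
pose k a b : K := fcoord F a b (h a b (fvec F a b)).
have hE a b y : h a b y = k a b *: y.
  rewrite [in LHS](fvecE F y) linearZ /= [X in _ *: X](fvecE F) scalerA mulrC.
  by rewrite -scalerA -(fvecE F y).
exists (k a0 b0) => a b y.
have [Sab|Sab] := pselect (sval S (a, b)); last exact: (eq_notin _ _ (hC S) Sab).
rewrite hE; congr (_ *: _).
apply: (@dshape_connected S (fun a b => k a b = k a0 b0)) S0 Sab _ => //.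
- move=> {y} {}a {}b Sa Sa1; suff -> : k a b = k (a + 1) b by [].
  have := dmap_d1 h (fvec F a b); rewrite !hE linearZ /= => /(congr1 (fcoord F _ _)).
  rewrite !linearZ /= fcoord_d1 fcoordK// mulr1.
  by move=> /(mulIf (fl_neq0 F Sa Sa1)).
- move=> {y} {}a {}b Sa Sa1; suff -> : k a b = k a (b + 1) by [].
  have := dmap_d2 h (fvec F a b); rewrite !hE linearZ /= => /(congr1 (fcoord F _ _)).
  rewrite !linearZ /= fcoord_d2 fcoordK// mulr1.
  by move=> /(mulIf (fm_neq0 F Sa Sa1)).
Qed.

(** The composite is a scalar [k]. If [k] is nonzero, [S] lies in [S'], and no arrow of [S'] joins
    [S] to its complement: commuting with this bijection would make [f] or [g] vanish at the end
    lying in [S]. Connectedness of [S'] then gives [S = S']. *)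
Lemma dshape_comp0 S S' (f : dmorphism (C S) (C S')) (g : dmorphism (C S') (C S)) :
  S <> S' -> forall a b y, g a b (f a b y) = 0.
Proof.
move=> SS' a b y; have [k kE] := dshape_endo (dcompose f g).
have {}kE c d z : g c d (f c d z) = k *: z by exact: kE.
rewrite kE; apply/eqP; rewrite scaler_eq0; apply/orP; left.
apply: contrapT => /negP k0; apply: SS'.
have [F] := dshape_frame S; have [F'] := dshape_frame S'.
have [_ C0 _ _] := hC S; have [_ C0' _ _] := hC S'.
have sub c d : sval S (c, d) -> sval S' (c, d).
  move=> Scd; apply: contrapT => Scd'; apply: (fvec_neq0 F Scd).
  have := kE c d (fvec F c d); rewrite (C0' _ _ Scd' (f _ _ _)) linear0.
  by move=> /esym/eqP; rewrite scaler_eq0 (negbTE k0) => /eqP.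
have gF c d : sval S (c, d) -> g c d (fvec F' c d) <> 0.
  move=> Scd g0; apply: (fvec_neq0 F Scd); apply/eqP.
  have := kE c d (fvec F c d); rewrite (fvecE F' (f _ _ _)) linearZ /= g0 scaler0.
  by move=> /esym/eqP; rewrite scaler_eq0 (negbTE k0).
have fF c d : sval S (c, d) -> f c d (fvec F c d) <> 0.
  move=> Scd f0; apply: (fvec_neq0 F Scd); apply/eqP.
  have := kE c d (fvec F c d); rewrite f0 linear0.
  by move=> /esym/eqP; rewrite scaler_eq0 (negbTE k0).
have [bij1 bij2] : (forall c d, sval S' (c, d) -> sval S' (c + 1, d) ->
      bijective (d1 (C S') c d)) /\ (forall c d, sval S' (c, d) ->
      sval S' (c, d + 1) -> bijective (d2 (C S') c d)) by case: (hC S').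
apply: dshape_eq; apply/seteqP; split=> [[c d]|[c d]]; first exact: sub.
have [a0 [b0 S0]] := dshape_inhabited S.
move=> S'cd.
apply: (@dshape_connected S' (fun a b => sval S (a, b)) _ _ _ _ _ _ (sub _ _ S0) S'cd S0).
- move=> {y} {}a {}b Sa Sa1; split=> S1; apply: contrapT => S2.
  + apply: (fF _ _ S1); apply: (bij_inj (bij1 _ _ Sa Sa1)).
    by rewrite -dmap_d1 (C0 _ _ S2 (d1 _ _ _ _)) !linear0.
  + apply: (gF _ _ S1); have [h _ hK] := bij1 _ _ Sa Sa1.
    by rewrite -[fvec _ _ _]hK dmap_d1 (C0 _ _ S2 (g _ _ _)) linear0.
- move=> {y} {}a {}b Sa Sa1; split=> S1; apply: contrapT => S2.
  + apply: (fF _ _ S1); apply: (bij_inj (bij2 _ _ Sa Sa1)).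
    by rewrite -dmap_d2 (C0 _ _ S2 (d2 _ _ _ _)) !linear0.
  + apply: (gF _ _ S1); have [h _ hK] := bij2 _ _ Sa Sa1.
    by rewrite -[fvec _ _ _]hK dmap_d2 (C0 _ _ S2 (g _ _ _)) linear0.
Qed.

(** A one-sided inverse is enough for an injection: [be] undoes [al], so the vectors [al j] are
    independent in a space spanned by vectors indexed by [m' S]. *)
Lemma shape_sum_inj (m m' : dshape -> Type)
    (f : dmorphism (shape_sum C m) (shape_sum C m'))
    (g : dmorphism (shape_sum C m') (shape_sum C m)) :
  (forall p q, cancel (f p q) (g p q)) ->
  forall S, exists i : m S -> m' S, injective i.
Proof.
move=> fK S; have [F] := dshape_frame S; have [a [b Sab]] := dshape_inhabited S.
pose L := C S a b; pose c : L := fvec F a b.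
pose Q n T : lmodType K := dcsum (fun _ : n T => C T) a b.
pose inc n T : dmorphism (dcsum (fun _ : n T => C T)) (shape_sum C n) :=
  dcsum_in (fun T => dcsum (fun _ : n T => C T)) T.
pose prj n T : dmorphism (shape_sum C n) (dcsum (fun _ : n T => C T)) :=
  dcsum_pr (fun T => dcsum (fun _ : n T => C T)) T.
pose al j := prj m' S a b (f a b (inc m S a b (dcsum_in (fun _ : m S => C S) j a b c))).
pose be x := prj m S a b (g a b (inc m' S a b x)).
have alK j : be (al j) = dcsum_in (fun _ : m S => C S) j a b c.
  set x := dcsum_in _ j a b c; rewrite /be /al -/x.
  set y := f a b (inc m S a b x).
  transitivity (prj m S a b (g a b y)); last by rewrite /y fK [LHS]dsum_prK.
  apply: dsum_prP => i; apply/eqP; rewrite -subr_eq0 -linearB -linearB -linearB /=.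
  (* Up to sign, [z] consists of the components of [y] of shapes other than [S]; the claim is that
     [g] returns none of them to an [S]-component. *)
  apply/eqP; set z := _ - y.
  pose G : {linear shape_sum C m' a b -> L} :=
    dcsum_pr (fun _ : m S => C S) i a b \o (prj m S a b \o g a b).
  change (G z = 0); apply: dsum_eq0 => T.
  have [<-|ST] := pselect (S = T).
    by rewrite /z linearB /= [X in X - _]dsum_prK subrr !linear0.
  pose G' : {linear Q m' T -> L} := G \o inc m' T a b.
  set w := dsum_pr _ T z; change (G' w = 0); apply: dsum_eq0 => k.
  pose f' : dmorphism (C S) (C T) :=
    dcompose (dcompose (dcompose (dcompose (dcsum_in (fun _ : m S => C S) j) (inc m S)) f)
      (prj m' T)) (dcsum_pr (fun _ : m' T => C T) k).
  pose g' : dmorphism (C T) (C S) :=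
    dcompose (dcompose (dcompose (dcompose (dcsum_in (fun _ : m' T => C T) k) (inc m' T)) g)
      (prj m S)) (dcsum_pr (fun _ : m S => C S) i).
  have -> : dsum_pr _ k w = - f' a b c.
    by rewrite /w /z linearB /= [X in X - _]dsum_pr_neq// sub0r linearN.
  have := dshape_comp0 f' g' ST (- c); rewrite linearN => <- //.
apply: (@independent_spanning_inj _ (Q m' S) _ _ al
  (fun k => dcsum_in (fun _ : m' S => C S) k a b c)).
- move=> j alj.
  have Qs : submodule [set x | dsum_pr (fun _ : m S => L) j (be x) = 0].
    split=> [|k x y /= x0 y0]; first by rewrite /= /be !linear0.
    rewrite /be !linearP /=; rewrite /be /= in x0 y0.
    by rewrite [X in _ *: X]x0 [X in _ + X]y0 scaler0 addr0.
  have : dsum_pr (fun _ : m S => L) j (be (al j)) = 0.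
    apply: (span_min Qs) alj => _ [i ij <-] /=; rewrite alK.
    by rewrite [LHS]dsum_pr_neq.
  by rewrite alK [LHS]dsum_prK; exact: fvec_neq0.
- move=> x; apply: (dsum_ind (submodule_span _)) => k y.
  rewrite (fvecE F y) linearZ; apply: (submoduleZ _ (submodule_span _)).
  by move=> R _; apply; exists k.
Qed.

Lemma same_card_inj (M N : Type) (f : M -> N) (g : N -> M) :
  injective f -> injective g -> same_card M N.
Proof.
move=> finj ginj.
have cle (X Y : Type) (h : X -> Y) : injective h -> ([set: X] #<= [set: Y])%card.
  move=> hinj; suff : $|{injfun [set: X] >-> [set: Y]}|.
    by case=> i; exact: inj_card_le i.
  by apply/injfunPex; exists h => // x y _ _; exact: hinj.
have /card_bijP[h [h' hK h'K]] : ([set: M] #= [set: N])%card.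
  by rewrite card_eq_le (cle _ _ _ finj) (cle _ _ _ ginj).
exists (fun x => val (h (to_setT x))); exists (fun y => val (h' (to_setT y))) => x.
- have -> : to_setT (val (h (to_setT x))) = h (to_setT x) by exact: val_inj.
  by rewrite hK.
- have -> : to_setT (val (h' (to_setT x))) = h' (to_setT x) by exact: val_inj.
  by rewrite h'K.
Qed.

End Uniqueness.

(** * Splitting off all copies of one shape *)

Section Total.
Variables (K : fieldType) (A : dcomplex K).

(** One vector space for all bidegrees: relations may link different components, and bidegrees that
    are equal only up to arithmetic need no casts. *)
Definition dtotal : lmodType K := dsum (fun pq : int * int => A pq.1 pq.2).

Definition dtotal_in a b : {linear A a b -> dtotal} :=
  dsum_in (fun pq : int * int => A pq.1 pq.2) (a, b).

Definition dtotal_pr a b : {linear dtotal -> A a b} :=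
  dsum_pr (fun pq : int * int => A pq.1 pq.2) (a, b).

Definition dtotal_lift (W : lmodType K) (h : forall a b, {linear A a b -> W}) :
  {linear dtotal -> W} :=
  dsum_lift (fun pq : int * int => h pq.1 pq.2).

Lemma dtotal_liftE (W : lmodType K) (h : forall a b, {linear A a b -> W}) a b x :
  dtotal_lift h (dtotal_in a b x) = h a b x.
Proof.
exact: (dsum_liftE (fun pq : int * int => h pq.1 pq.2) (i := (a, b)) x).
Qed.

Lemma dtotal_prK a b x : dtotal_pr a b (dtotal_in a b x) = x.
Proof.
exact: (dsum_prK (V := fun pq : int * int => A pq.1 pq.2) (i := (a, b)) x).
Qed.

Lemma dtotal_pr_neq a b a' b' x :
  (a, b) <> (a', b') -> dtotal_pr a' b' (dtotal_in a b x) = 0.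
Proof.
exact: (dsum_pr_neq (V := fun pq : int * int => A pq.1 pq.2) (i := (a, b)) x).
Qed.

Lemma dtotal_ext (W : lmodType K) (h g : {linear dtotal -> W}) :
  (forall a b x, h (dtotal_in a b x) = g (dtotal_in a b x)) -> h =1 g.
Proof. by move=> hg; apply: dsum_ext => -[a b] x; exact: hg. Qed.

End Total.

Lemma scaleby_exists (K : fieldType) (V : lmodType K) (v : V) :
  exists h : {linear K^o -> V}, forall k, h k = (k : K) *: v.
Proof.
have [|h hE] := @linear_exists K K^o V (fun k : K^o => (k : K) *: v).
  by move=> k x y; rewrite scalerDl scalerA.
by exists h.
Qed.

Section Peel.
Variables (K : fieldType) (C : dshape -> dcomplex K).
Hypothesis hC : forall S : dshape, has_shape (C S) (sval S).
Variables (A : dcomplex K) (S : dshape).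

Definition no_summand : Prop := forall (s : dmorphism (C S) A)
  (f : dmorphism A (C S)) p q x, f p q (s p q x) = 0.

(* A linear map kills these relations iff its components on the A^{p,q} are   *)
(* the coordinates of a morphism A -> C(S).                                   *)
Definition shape_rel (F : frame (C S) (sval S)) : set (dtotal A) :=
  [set t | [\/ exists a b y, ~ sval S (a, b) /\ t = dtotal_in A a b y,
     exists a b y, t = dtotal_in A (a + 1) b (d1 A a b y) - fl F a b *: dtotal_in A a b y
   | exists a b y,
       t = dtotal_in A a (b + 1) (d2 A a b y) - fm F a b *: dtotal_in A a b y]].

Lemma shape_rel_kill (F : frame (C S) (sval S)) (f : dmorphism A (C S)) :
  exists h : {linear dtotal A -> K^o}, (forall t, shape_rel F t -> h t = 0) /\
    forall a b y, h (dtotal_in A a b y) = fcoord F a b (f a b y).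
Proof.
pose h a b : {linear A a b -> K^o} := fcoord F a b \o f a b.
exists (dtotal_lift h); split=> [t|a b y]; last by rewrite dtotal_liftE.
case=> -[a [b [y]]] => [[Sab ->]| -> | ->]; rewrite ?linearB ?linearZ /= !dtotal_liftE.
- exact: fcoord_notin (hC S).
- by rewrite /h /= dmap_d1 fcoord_d1 scalerN; exact: subrr.
- by rewrite /h /= dmap_d2 fcoord_d2 scalerN; exact: subrr.
Qed.

(** [b s] represents the class of [s] in the colimit. On a basis, modulo the relations, of the span
    of all [b s], coordinates are defined, and [h] extends them to [dtotal A]. *)
Lemma shape_dual_basis (F : frame (C S) (sval S)) a0 b0 :
  exists (J : set (dmorphism (C S) A))
    (h : {linear dtotal A -> dsum (fun _ : {s | J s} => K^o : lmodType K)}),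
  let b (s : dmorphism (C S) A) := dtotal_in A a0 b0 (s a0 b0 (fvec F a0 b0)) in
  [/\ forall t, shape_rel F t -> h t = 0,
      forall j, h (b (sval j)) = dsum_in (fun=> K^o : lmodType K) j 1
    & forall s, lspan (shape_rel F `|` b @` J) (b s)].
Proof.
pose b (s : dmorphism (C S) A) := dtotal_in A a0 b0 (s a0 b0 (fvec F a0 b0)).
have [J [Jfree Jspan]] := basis_modulo b (shape_rel F).
have sig_inj (i j : {s | J s}) : sval i = sval j -> i = j.
  case: i j => [i Ji] [j Jj] /= ij; subst; congr exist; exact: Prop_irrelevance.
exists J; set V := dsum _.
pose e j : V := dsum_in (fun=> K^o : lmodType K) j 1.
pose pr j : {linear V -> K^o} := dsum_pr _ j.
pose G : set (dtotal A * V)%type := [set g | (shape_rel F g.1 /\ g.2 = 0) \/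
  exists j, g = (b (sval j), e j)].
have [w Gw|h hG] := @linear_extension K (dtotal A) V G.
  apply: dsum_prP => j; rewrite linear0; apply: contrapT => /eqP wj.
  apply: (Jfree _ (svalP j)).
  set Y := _ `|` _.
  have sY := submodule_span Y.
  (* Subtracting the [j]-th coordinate times [b (sval j)] sends all of [G] into the span that omits
     [j]. For [(0, w)] a nonzero coordinate would put [b (sval j)] itself there. *)
  have : lspan Y (0 - (pr j w : K) *: b (sval j)).
    move: Gw; apply: (span_min (Q := [set g | lspan Y (g.1 - (pr j g.2 : K) *: b (sval j))])).
      split=> [|k u v /= Yu Yv].
        by rewrite /= linear0 scale0r subrr; exact: sY.1.
      have := sY.2 k _ _ Yu Yv; congr (lspan Y _).
      rewrite linearP scalerDl scalerBr opprD addrACA; congr (_ + (_ + _)).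
      by rewrite scalerA.
    move=> [u v] [[Ru /= ->]|[i [-> ->]]] /=.
      by rewrite linear0 scale0r subr0 => R _; apply; left.
    have [<-|ij] := pselect (i = j).
      by rewrite /pr /e dsum_prK scale1r subrr; exact: sY.1.
    rewrite /pr /e dsum_pr_neq// scale0r subr0 => R _; apply; right.
    exists (sval i) => //; split; first exact: svalP.
    by move=> /= /sig_inj.
  move=> /(submoduleZ (- (pr j w : K)^-1) sY).
  by rewrite sub0r scalerN scaleNr opprK scalerA mulVf// scale1r.
exists h; split=> [t Rt|j|s]; last exact: Jspan.
  by apply: hG; left.
by apply: hG; right; exists j.
Qed.

Lemma peel : exists (J : Type) (s : dmorphism (dcsum (fun _ : J => C S)) A)
    (f : dmorphism A (dcsum (fun _ : J => C S))),
  (forall p q x, f p q (s p q x) = x) /\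
  forall (s' : dmorphism (C S) (dkernel f)) (f' : dmorphism (dkernel f) (C S)) p q x,
    f' p q (s' p q x) = 0.
Proof.
have [F] := dshape_frame hC S; have [a0 [b0 S0]] := dshape_inhabited S.
have [J [h [hrel hdual hspan]]] := shape_dual_basis F a0 b0.
pose T := {s | J s}.
pose sc a b := cid (scaleby_exists (fvec F a b)).
have scE a b k : sval (sc a b) k = (k : K) *: fvec F a b by exact: (svalP (sc a b)).
pose m a b : {linear dsum (fun _ : T => K^o : lmodType K) -> dcsum (fun _ : T => C S) a b} :=
  dsum_map (fun _ : T => sval (sc a b)).
pose f0 a b : {linear A a b -> dcsum (fun _ : T => C S) a b} :=
  m a b \o (h \o dtotal_in A a b).
have f0E a b y j : dsum_pr (fun=> C S a b) j (f0 a b y) =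
    (dsum_pr _ j (h (dtotal_in A a b y)) : K) *: fvec F a b.
  by rewrite [LHS](dsum_mapE (fun _ : T => sval (sc a b))) scE.
have h1 a b y : h (dtotal_in A (a + 1) b (d1 A a b y)) =
    fl F a b *: h (dtotal_in A a b y).
  apply/eqP; rewrite -subr_eq0 -linearZ -linearB; apply/eqP/hrel.
  by apply: Or32; exists a, b, y.
have h2 a b y : h (dtotal_in A a (b + 1) (d2 A a b y)) =
    fm F a b *: h (dtotal_in A a b y).
  apply/eqP; rewrite -subr_eq0 -linearZ -linearB; apply/eqP/hrel.
  by apply: Or33; exists a, b, y.
have f1 a b y : f0 (a + 1) b (d1 A a b y) = d1 (dcsum (fun _ : T => C S)) a b (f0 a b y).
  apply: dsum_prP => j; rewrite [RHS]dcsum_d1 !f0E h1 !linearZ /= fvec_d1.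
  by rewrite scalerA mulrC.
have f2 a b y : f0 a (b + 1) (d2 A a b y) = d2 (dcsum (fun _ : T => C S)) a b (f0 a b y).
  apply: dsum_prP => j; rewrite [RHS]dcsum_d2 !f0E h2 !linearZ /= fvec_d2.
  by rewrite scalerA mulrC.
pose f : dmorphism A (dcsum (fun _ : T => C S)) := DMorphism f1 f2.
pose s : dmorphism (dcsum (fun _ : T => C S)) A :=
  dcsum_lift (fun j : T => sval j).
have fs p q x : f p q (s p q x) = x.
  move: p q x => a b; have [Sab|Sab] := pselect (sval S (a, b)); last first.
    by move=> x; apply: dsum_prP => j; exact: (eq_notin _ _ (hC S) Sab).
  apply: (@dsum_ext _ _ _ _ (f a b \o s a b) idfun) => j y /=.
  (* Duality holds at the base point and spreads along the arrows, whose matrix entries are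
     nonzero. *)
  have hj : h (dtotal_in A a b (sval j a b (fvec F a b))) = dsum_in (fun=> K^o : lmodType K) j 1.
    apply: (@dshape_connected S (fun a b => h (dtotal_in A a b (sval j a b (fvec F a b)))
      = dsum_in (fun=> K^o : lmodType K) j 1) _ _ _ _ _ _ S0 Sab (hdual j)).
    - move=> {y} c d Sc Sc1; suff -> : h (dtotal_in A c d (sval j c d (fvec F c d))) =
          h (dtotal_in A (c + 1) d (sval j (c + 1) d (fvec F (c + 1) d))) by [].
      apply: (scalerI (fl_neq0 F Sc Sc1)); rewrite -h1 -dmap_d1 fvec_d1.
      by rewrite !linearZ.
    - move=> {y} c d Sc Sc1; suff -> : h (dtotal_in A c d (sval j c d (fvec F c d))) =
          h (dtotal_in A c (d + 1) (sval j c (d + 1) (fvec F c (d + 1)))) by [].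
      apply: (scalerI (fm_neq0 F Sc Sc1)); rewrite -h2 -dmap_d2 fvec_d2.
      by rewrite !linearZ.
  rewrite dsum_liftE [in LHS](fvecE F y) !linearZ /= hj.
  rewrite /m [in LHS]dsum_map_in scE scale1r -linearZ -fvecE.
  by [].
exists T, s, f; split=> // s' f' p q x.
  (* A pair of maps through the kernel extends to one through [A] with the same composite, because
     [dkernel_pr] retracts [dkernel_in]. *)
  pose s2 : dmorphism (C S) A := dcompose s' (dkernel_in f).
  pose f3 : dmorphism A (C S) := dcompose (dkernel_pr fs) f'.
  have [g [grel gE]] := shape_rel_kill F f3.
  have [k kE] := dshape_endo hC (dcompose s' f').
  rewrite -[LHS]/(dcompose s' f' p q x) kE; suff -> : k = 0 by rewrite scale0r.
  pose gj (j : T) := cid (scaleby_exists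
    (g (dtotal_in A a0 b0 (sval j a0 b0 (fvec F a0 b0))))).
  have gjE j c : sval (gj j) c = c *: g (dtotal_in A a0 b0 (sval j a0 b0 (fvec F a0 b0))).
    exact: (svalP (gj j)).
  pose g' := dsum_lift (fun j : T => sval (gj j)).
  (* [g] and [g' \o h] agree on the relations and on the chosen basis, hence on every [b s]. *)
  have gh : g (dtotal_in A a0 b0 (s2 a0 b0 (fvec F a0 b0))) =
      g' (h (dtotal_in A a0 b0 (s2 a0 b0 (fvec F a0 b0)))).
    move: (hspan s2); apply: (span_min (Q := [set t | g t = g' (h t)])).
      split=> [|c u v /= gu gv]; first by rewrite /= !linear0.
      by rewrite !linearP gu gv.
    move=> t [Rt|[j Jj <-]] /=; first by rewrite grel// hrel// linear0.
    by rewrite (hdual (exist _ j Jj)) /g' dsum_liftE gjE scale1r.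
  (* [s2] takes values in the kernel of [f], and the coordinates of [f] are those of [h]. *)
  have h0 : h (dtotal_in A a0 b0 (s2 a0 b0 (fvec F a0 b0))) = 0.
    apply: dsum_prP => j; rewrite linear0; apply/eqP.
    have := f0E a0 b0 (s2 a0 b0 (fvec F a0 b0)) j.
    rewrite [f0 _ _ _](@dkernel_inP _ _ _ f) linear0 => /esym/eqP.
    by rewrite scaler_eq0 => /orP[//|/eqP]/(fvec_neq0 F S0).
  move: gh; rewrite h0 linear0 gE /f3 dcomposeE /s2 dcomposeE dkernel_prK.
  rewrite -[f' _ _ _]/(dcompose s' f' _ _ _) kE linearZ /= fcoordK// => k0.
  by rewrite -[k]mulr1; exact: k0.
Qed.

End Peel.

(** * Existence of a summand *)

(** [G] is the graph of the functional on [Q + K w] that is 0 on [Q] and 1 at [w]. *)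
Lemma functional_exists (K : fieldType) (V : lmodType K) (Q : set V) w :
  submodule Q -> ~ Q w ->
  exists h : {linear V -> K^o}, (forall v, Q v -> h v = 0) /\ h w = 1.
Proof.
move=> sQ Qw; pose G : set (V * K^o)%type := [set g | Q (g.1 - (g.2 : K) *: w)].
have sG : submodule G.
  split=> [|k u v Gu Gv]; first by rewrite /G /= scale0r subrr; exact: sQ.1.
  have := sQ.2 k _ _ Gu Gv; rewrite /G /=; congr Q.
  by rewrite scalerDl scalerBr opprD addrACA scalerA.
have [c|h hG] := @linear_extension K _ K^o G.
  move=> /(_ G sG (fun _ => id)); rewrite /G /= sub0r.
  have [->//|c0] := eqVneq c 0.
  move=> /(submoduleZ (- (c : K)^-1) sQ).
  by rewrite scalerN scaleNr opprK scalerA mulVf// scale1r => /Qw.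
exists h; split=> [v Qv|]; apply: hG; rewrite /G /=.
  by rewrite scale0r subr0.
by rewrite scale1r subrr; exact: sQ.1.
Qed.

(* f i and g i model the arrows d1 and d2 of a zigzag: source i -> target i   *)
(* and source i.+1 -> target i. The induction moves the pair U < W from one   *)
(* source to the next; [e] tells whether the zigzag ends at a target.         *)
Lemma chain_exists (K : fieldType) (T : lmodType K) (n : nat)
    (f g : nat -> {linear T -> T}) (U W : set T) :
  submodule U -> submodule W -> U `<=` W -> (exists2 w, W w & ~ U w) ->
  (forall i t, (n <= i)%N -> f i t = 0) ->
  exists (b : nat) (e : bool) (x : nat -> T) (phi psi : nat -> {linear T -> K^o}),
  [/\ phi 0%N (x 0%N) = 1 /\ W (x 0%N),
      forall u, U u -> phi 0%N u = 0,
      forall i, (i < b)%N ->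
        f i (x i) = g i (x i.+1) /\ forall t, psi i (g i t) = phi i.+1 t,
      forall i t, (i < b + e)%N -> psi i (f i t) = phi i t
    & if e then forall t, psi b (g b t) = 0 else f b (x b) = 0].
Proof.
elim: n f g U W => [|n IH] f g U W sU sW UW [w0 Ww0 Uw0] fn.
  have [h [hU hw]] := functional_exists sU Uw0.
  exists 0%N, false, (fun=> w0), (fun=> h), (fun=> h); split=> //.
  exact: fn.
(* A vector of [W] outside [U] killed by [f 0] lets the zigzag end at the current source. *)
have [[w [Ww Uw fw]]|NA] := pselect (exists w, [/\ W w, ~ U w & f 0%N w = 0]).
  have [h [hU hw]] := functional_exists sU Uw.
  by exists 0%N, false, (fun=> w), (fun=> h), (fun=> h); split.
have kerU w : W w -> f 0%N w = 0 -> U w.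
  by move=> Ww fw; apply: contrapT => Uw; apply: NA; exists w.
have [[w [y [Ww Uw fw]]]|NB] := pselect (exists w y, [/\ W w, ~ U w & f 0%N w = g 0%N y]);
  last first.
  (* No vector of [W] outside [U] continues to the next source, so the zigzag ends at the target:
     [f 0 w0] lies outside [im g + f U], and a functional separates them. *)
  pose Q := [set v | exists y u, U u /\ v = g 0%N y + f 0%N u].
  have sQ : submodule Q.
    split=> [|k _ _ [y [u [Uu ->]]] [y' [u' [Uu' ->]]]].
      by exists 0, 0; rewrite !linear0 addr0; split=> //; exact: sU.1.
    exists (k *: y + y'), (k *: u + u'); split; first exact: sU.2.
    by rewrite !linearP scalerDr addrACA.
  have [|h [hQ hw]] := @functional_exists _ _ Q (f 0%N w0) sQ.
    case=> y [u [Uu fw]]; apply: NB; exists (w0 - u), y; split.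
    - by apply: submoduleB => //; exact: UW.
    - by move=> /(submoduleD sU)/(_ Uu); rewrite subrK.
    - by rewrite linearB fw addrK.
  exists 0%N, true, (fun=> w0), (fun=> h \o f 0%N), (fun=> h); split=> //=.
  - by move=> u Uu; apply: hQ; exists 0, u; rewrite linear0 add0r.
  - by case.
  - by move=> t; apply: hQ; exists t, 0; rewrite linear0 addr0; split=> //; exact: sU.1.
(* The image of [X] under the linear relation [g^-1 f]. Since [ker f] meets [W] inside [U], the
   images of [U] and [W] are again distinct. *)
pose pull (X : set T) := [set y | exists2 u, X u & g 0%N y = f 0%N u].
have spull X : submodule X -> submodule (pull X).
  move=> sX; split=> [|k v v' [u Xu vu] [u' Xu' vu']].
    by exists 0; rewrite ?linear0//; exact: sX.1.
  by exists (k *: u + u'); [exact: sX.2|rewrite !linearP vu vu'].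
have [||b [e [x [phi [psi [[phi1 [x0 Wx0 gx0]] phiU rel psif endc]]]]]] :=
    IH (fun i => f i.+1) (fun i => g i.+1) (pull U) (pull W) (spull _ sU) (spull _ sW) _ _
      (fun i t => fn i.+1 t).
- by move=> v [u Uu vu]; exists u => //; exact: UW.
- exists y; first by exists w.
  case=> u Uu gu; apply: Uw; rewrite -[w](subrK u); apply: submoduleD => //.
  apply: kerU; first by apply: submoduleB => //; exact: UW.
  by rewrite linearB fw gu subrr.
(* The functional on the target has to equal [phi 0] on [g y] and vanish on [f U]. This is
   consistent: [g y + f u = 0] puts [y] into [pull U], which [phi 0] kills. *)
pose G : set (T * K^o)%type :=
  [set p | exists y u, [/\ U u, p.1 = g 0%N y + f 0%N u & p.2 = phi 0%N y]].
have sG : submodule G.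
  split=> [|k [_ _] [_ _] [y1 [u1 [/= Uu1 -> ->]]] [y2 [u2 [/= Uu2 -> ->]]]].
    by exists 0, 0; rewrite !linear0 addr0; split=> //; exact: sU.1.
  exists (k *: y1 + y2), (k *: u1 + u2); rewrite !linearP /= scalerDr addrACA.
  by split=> //; exact: sU.2.
have [c|h hG] := @linear_extension K _ K^o G.
  move=> /(_ G sG (fun _ => id))[z [u [/= Uu /esym/eqP]]].
  rewrite addr_eq0 => /eqP zu ->; apply: phiU; exists (- u); last by rewrite linearN.
  exact: submoduleN.
have hg z : h (g 0%N z) = phi 0%N z.
  by apply: hG; exists z, 0; rewrite linear0 addr0; split=> //; exact: sU.1.
pose hf : {linear T -> K^o} := h \o f 0%N.
exists b.+1, e, (fun i => if i is j.+1 then x j else x0).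
exists (fun i => if i is j.+1 then phi j else hf).
exists (fun i => if i is j.+1 then psi j else h).
split=> [||[|i] ib|[|i] t ib|].
- by split=> //=; rewrite -gx0 hg.
- move=> u Uu; apply: hG; exists 0, u; split=> //; last by rewrite linear0.
  by rewrite linear0 add0r.
- by split.
- exact: rel.
- by [].
- exact: psif.
- by [].
Qed.

(** * The two differentials on the total space *)

Section Differentials.
Variables (K : fieldType) (A : dcomplex K).

Definition D1 : {linear dtotal A -> dtotal A} :=
  dtotal_lift (fun a b => dtotal_in A (a + 1) b \o d1 A a b).

Definition D2 : {linear dtotal A -> dtotal A} :=
  dtotal_lift (fun a b => dtotal_in A a (b + 1) \o d2 A a b).

Lemma D1E a b x : D1 (dtotal_in A a b x) = dtotal_in A (a + 1) b (d1 A a b x).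
Proof. exact: dtotal_liftE. Qed.

Lemma D2E a b x : D2 (dtotal_in A a b x) = dtotal_in A a (b + 1) (d2 A a b x).
Proof. exact: dtotal_liftE. Qed.

Lemma D1D1 t : D1 (D1 t) = 0.
Proof.
apply: (dtotal_ext (h := D1 \o D1) (g := \0 : {linear dtotal A -> dtotal A})).
by move=> a b x; rewrite /= !D1E d1d1 linear0.
Qed.

Lemma D2D2 t : D2 (D2 t) = 0.
Proof.
apply: (dtotal_ext (h := D2 \o D2) (g := \0 : {linear dtotal A -> dtotal A})).
by move=> a b x; rewrite /= !D2E d2d2 linear0.
Qed.

Lemma D2D1 t : D2 (D1 t) = - D1 (D2 t).
Proof.
apply: (dtotal_ext (h := D2 \o D1) (g := -%R \o (D1 \o D2))).
move=> a b x; rewrite /= !(D1E, D2E) -linearN; congr (dtotal_in _ _ _ _).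
by have /eqP := d1d2 x; rewrite addr_eq0 => /eqP ->; rewrite opprK.
Qed.

Lemma dtotal_pr_D1 a b t : dtotal_pr A (a + 1) b (D1 t) = d1 A a b (dtotal_pr A a b t).
Proof.
apply: (dtotal_ext (h := dtotal_pr A (a + 1) b \o D1) (g := d1 A a b \o dtotal_pr A a b)).
move=> c d x; rewrite /= D1E.
have [cd|cd] := pselect ((c, d) = (a, b)).
  by case: cd x => -> -> x; rewrite !dtotal_prK.
by rewrite !dtotal_pr_neq ?linear0// => -[/addIr ca db]; apply: cd; rewrite ca db.
Qed.

Lemma dtotal_pr_D2 a b t : dtotal_pr A a (b + 1) (D2 t) = d2 A a b (dtotal_pr A a b t).
Proof.
apply: (dtotal_ext (h := dtotal_pr A a (b + 1) \o D2) (g := d2 A a b \o dtotal_pr A a b)).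
move=> c d x; rewrite /= D2E.
have [cd|cd] := pselect ((c, d) = (a, b)).
  by case: cd x => -> -> x; rewrite !dtotal_prK.
by rewrite !dtotal_pr_neq ?linear0// => -[ca /addIr db]; apply: cd; rewrite ca db.
Qed.

Definition dtotal_at a b : {linear dtotal A -> dtotal A} := dtotal_in A a b \o dtotal_pr A a b.

Lemma dtotal_at_in a b x : dtotal_at a b (dtotal_in A a b x) = dtotal_in A a b x.
Proof. by rewrite /dtotal_at /= dtotal_prK. Qed.

Lemma dtotal_in_inj a b : injective (dtotal_in A a b).
Proof. exact: can_inj (@dtotal_prK _ A a b). Qed.
End Differentials.

(** [b + 1] consecutive sources with the targets between them; [l] and [e] add a target at the left
    and right end. Equal flags give the two kinds of odd zigzags, different flags the even ones. *)
Lemma zigzag_interval (p q : int) (b : nat) (l e : bool) :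
  exists S : dshape, forall a c, sval S (a, c) <->
    (a + c = p + q /\ p <= a <= p + b%:Z) \/
    (a + c = p + q + 1 /\ p + (~~ l)%:Z <= a <= p + b%:Z + e%:Z).
Proof.
have mk T : zigzag_shape T -> exists S : dshape, sval S = T.
  by move=> Z; exists (exist _ T (or_intror Z)).
case: l e => -[].
- have Z : zigzag_shape (odd_pts (p + q + 1) (p + b%:Z + 1) (q + 1)) by apply: Or33; do 3 eexists.
  have [S SE] := mk _ Z; exists S => a c; rewrite SE /odd_pts ifF; last by lia.
  split=> [[] [j /= jP [<- <-]]|[]]; [right; lia|left; lia| |].
  + by right; exists a => /=; [lia|congr pair; lia].
  + by left; exists a => /=; [lia|congr pair; lia].
- have Z : zigzag_shape (even2_pts (b%:Z + 1) (p + b%:Z) (q - b%:Z)).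
    by apply: Or32; do 3 eexists; split; last reflexivity; lia.
  have [S SE] := mk _ Z; exists S => a c; rewrite SE.
  split=> [[j [jP [] [-> ->]]]|[]]; [left; lia|right; lia| |].
  + by exists (p + b%:Z - a); split; [lia|left; congr pair; lia].
  + by exists (p + b%:Z - a); split; [lia|right; congr pair; lia].
- have Z : zigzag_shape (even1_pts (b%:Z + 1) p q).
    by apply: Or31; do 3 eexists; split; last reflexivity; lia.
  have [S SE] := mk _ Z; exists S => a c; rewrite SE.
  split=> [[j [jP [] [-> ->]]]|[]]; [left; lia|right; lia| |].
  + by exists (a - p); split; [lia|left; congr pair; lia].
  + by exists (a - p - 1); split; [lia|right; congr pair; lia].
- have Z : zigzag_shape (odd_pts (p + q) p (q - b%:Z)) by apply: Or33; do 3 eexists.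
  have [S SE] := mk _ Z; exists S => a c; rewrite SE /odd_pts ifT; last by lia.
  split=> [[] [j /= jP [<- <-]]|[]]; [left; lia|right; lia| |].
  + by left; exists a => /=; [lia|congr pair; lia].
  + by right; exists a => /=; [lia|congr pair; lia].
Qed.

(** * Squares split off where d1 d2 is nonzero *)

Section SummandExists.
Variables (K : fieldType) (C : dshape -> dcomplex K).
Hypothesis hC : forall S : dshape, has_shape (C S) (sval S).
Variable A : dcomplex K.

(** A square is free on a generator at its lower left corner and cofree at its upper right one: [x]
    determines [s], and a functional [chi] with value 1 at [d1 (d2 x)] determines [f]. *)
Lemma square_summand p q (x : A p q) :
  d1 A p (q + 1) (d2 A p q x) <> 0 -> exists S, ~ no_summand C A S.
Proof.
move=> dx0; have Sq : square_shape (square_pts (p + 1) (q + 1)) by exists (p + 1), (q + 1).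
pose S : dshape := exist _ (square_pts (p + 1) (q + 1)) (or_introl Sq).
have SE a b : sval S (a, b) <-> (a = p \/ a = p + 1) /\ (b = q \/ b = q + 1).
  by rewrite /S /= square_cases !addrK; split=> -[[]->[]->]; auto.
exists S => NS; have [F] := dshape_frame hC S.
have S00 : sval S (p, q) by apply/SE; auto.
have S10 : sval S (p + 1, q) by apply/SE; auto.
have S01 : sval S (p, q + 1) by apply/SE; auto.
have S11 : sval S (p + 1, q + 1) by apply/SE; auto.
have l0 := fl_neq0 F S00 S10; have l1 := fl_neq0 F S01 S11.
have m0 := fm_neq0 F S00 S01; have m1 := fm_neq0 F S10 S11.
(* Anticommutation in matrix entries; it accounts for the signs below. *)
have lm : fm F p q * fl F p (q + 1) + fl F p q * fm F (p + 1) q = 0.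
  have := congr1 (fcoord F (p + 1) (q + 1)) (d1d2 (fvec F p q)).
  by rewrite linearD linear0 /= fcoord_d1 fcoord_d2 fcoord_d2 fcoord_d1 fcoordK// !mulr1
    mulrC [X in _ + X]mulrC.
set l00 := fl F p q in l0 lm; set l01 := fl F p (q + 1) in l1 lm.
set m00 := fm F p q in m0 lm; set m10 := fm F (p + 1) q in m1 lm.
pose t := dtotal_in A p q x.
(* The corner components of [T] are the images of the basis vectors; each coefficient inverts the
   matrix entries on a way from [(p, q)] to the corner. *)
pose T := t + l00^-1 *: D1 A t + m00^-1 *: D2 A t + (m00 * l01)^-1 *: D1 A (D2 A t).
pose v a b := dtotal_pr A a b T.
have vE a b : v a b = dtotal_pr A a b t + l00^-1 *: dtotal_pr A a b (D1 A t) +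
    m00^-1 *: dtotal_pr A a b (D2 A t) +
    (m00 * l01)^-1 *: dtotal_pr A a b (D1 A (D2 A t)) by rewrite /v !linearD !linearZ.
have D1t : D1 A t = dtotal_in A (p + 1) q (d1 A p q x) by rewrite /t D1E.
have D2t : D2 A t = dtotal_in A p (q + 1) (d2 A p q x) by rewrite /t D2E.
have D12t : D1 A (D2 A t) = dtotal_in A (p + 1) (q + 1) (d1 A p (q + 1) (d2 A p q x)).
  by rewrite D2t D1E.
have prn a b c d (y : A c d) : a <> c \/ b <> d -> dtotal_pr A a b (dtotal_in A c d y) = 0.
  by move=> ne; apply: dtotal_pr_neq => -[ca db]; case: ne => []; apply.
have v00 : v p q = x.
  rewrite vE D12t D1t D2t /t dtotal_prK !prn; try lia.
  by rewrite !scaler0 !addr0.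
have v10 : v (p + 1) q = l00^-1 *: d1 A p q x.
  rewrite vE D12t D1t D2t /t dtotal_prK !prn; try lia.
  by rewrite !scaler0 !addr0 add0r.
have v01 : v p (q + 1) = m00^-1 *: d2 A p q x.
  rewrite vE D12t D1t D2t /t dtotal_prK !prn; try lia.
  by rewrite !scaler0 !addr0 add0r.
have v11 : v (p + 1) (q + 1) = (m00 * l01)^-1 *: d1 A p (q + 1) (d2 A p q x).
  rewrite vE D12t D1t D2t /t dtotal_prK !prn; try lia.
  by rewrite !scaler0 !addr0 add0r.
have flN a b : ~ sval S (a + 1, b) -> fl F a b = 0 by move=> nS; apply: fl0 => -[].
have fmN a b : ~ sval S (a, b + 1) -> fm F a b = 0 by move=> nS; apply: fm0 => -[].
have d21 : d2 A (p + 1) q (d1 A p q x) = - d1 A p (q + 1) (d2 A p q x).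
  by have /eqP := d1d2 x; rewrite addr_eq0 => /eqP ->; rewrite opprK.
have [s sE] : exists s : dmorphism (C S) A, forall a b y,
    s a b y = (fcoord F a b y : K) *: v a b.
  apply: frame_hom_from (hC S) _ _ => a b /SE[[] -> [] ->].
  - by rewrite v00 v10 scalerA mulfV// scale1r.
  - by rewrite v01 v11 linearZ /= scalerA invfM mulrCA mulfV// mulr1.
  - by rewrite v10 linearZ /= d1d1 scaler0 flN ?scale0r// => /SE; lia.
  - by rewrite v11 linearZ /= d1d1 scaler0 flN ?scale0r// => /SE; lia.
  - by rewrite v00 v01 scalerA mulfV// scale1r.
  - by rewrite v01 linearZ /= d2d2 scaler0 fmN ?scale0r// => /SE; lia.
  - rewrite v10 v11 linearZ /= d21 scalerN -scaleNr scalerA; congr (_ *: _).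
    move/eqP: lm; rewrite addr_eq0 => /eqP ->.
    by rewrite -[fm _ _ _]/m10 invrN mulrN invfM mulrA mulrC mulrA mulVf ?mul1r// mulrC.
  - rewrite v11 linearZ /=; have /eqP := d1d2 (d2 A p q x).
    rewrite d2d2 linear0 add0r => /eqP ->.
    by rewrite scaler0 fmN ?scale0r// => /SE; lia.
have s0 : submodule [set (0 : A (p + 1) (q + 1))].
  by split=> // k y z /= -> ->; rewrite scaler0 addr0.
have [chi [_ chi1]] := functional_exists s0 dx0.
pose chi' : {linear dtotal A -> K^o} := chi \o dtotal_pr A (p + 1) (q + 1).
(* Dually, [chi] composed with the ways into the upper right corner, divided by their matrix
   entries. *)
pose ut t : K := chi' t + m10^-1 * chi' (D2 A t) + l01^-1 * chi' (D1 A t) +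
  (m00 * l01)^-1 * chi' (D1 A (D2 A t)).
have utl : linear (ut : dtotal A -> K^o).
  move=> k y z; rewrite /ut !linearP /=.
  set a1 := chi _; set a2 := chi _; set a3 := chi _; set a4 := chi _.
  by rewrite /GRing.scale /=; ring.
have [u uE] := linear_exists utl.
have chi0 a b (y : A a b) : a <> p + 1 \/ b <> q + 1 -> chi' (dtotal_in A a b y) = 0.
  by move=> ne; rewrite /chi' /= prn ?linear0//; case: ne => ne; [left|right]; exact: nesym.
have uin a b (y : A a b) : u (dtotal_in A a b y) = chi' (dtotal_in A a b y) +
    m10^-1 * chi' (dtotal_in A a (b + 1) (d2 A a b y)) +
    l01^-1 * chi' (dtotal_in A (a + 1) b (d1 A a b y)) + (m00 * l01)^-1 *
    chi' (dtotal_in A (a + 1) (b + 1) (d1 A a (b + 1) (d2 A a b y))).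
  by rewrite uE /ut !(D2E, D1E).
have d210 a b (y : A a b) : d2 A (a + 1) b (d1 A a b y) = - d1 A a (b + 1) (d2 A a b y).
  by have /eqP := d1d2 y; rewrite addr_eq0 => /eqP ->; rewrite opprK.
have [f fE] : exists f : dmorphism A (C S), forall a b y,
    f a b y = (u (dtotal_in A a b y) : K) *: fvec F a b.
  apply: (frame_hom_to (u := fun a b => u \o dtotal_in A a b)) (hC S) _ _ => a b y Sab.
  - have [Sab'|Sab'] := pselect (sval S (a, b)); last first.
      rewrite fl0; last by case.
      rewrite mul0r /= uin d1d1 d210 !linearN d1d1 !linear0 !mulr0 !addr0.
      by rewrite !chi0 ?oppr0 ?mulr0 ?addr0//; move: Sab Sab' => /SE + /SE; lia.
    have {Sab Sab'}[ap [bq|bq]] : a = p /\ (b = q \/ b = q + 1)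
        by move: Sab Sab' => /SE + /SE; lia.
    + subst a b; rewrite /= !uin d1d1 !d210 !linearN d1d1 !linear0.
      set X := chi' (dtotal_in A (p + 1) (q + 1) _); rewrite !chi0; try by lia.
      rewrite ?oppr0 !mulr0 !add0r !addr0 mulrN -mulNr mulrA; congr (_ * _).
      move/eqP: lm; rewrite addr_eq0 => /eqP ->.
      by rewrite -/l00 invrN mulrN invfM mulrA mulfV ?mul1r.
    + subst a b; rewrite /= !uin d1d1 !d210 !linearN d1d1 !linear0.
      set X := chi' (dtotal_in A (p + 1) (q + 1) _); rewrite !chi0; try by lia.
      by rewrite ?oppr0 !mulr0 !add0r !addr0 mulrA mulfV ?mul1r.
  - have [Sab'|Sab'] := pselect (sval S (a, b)); last first.
      rewrite fm0; last by case.
      rewrite mul0r /= uin d2d2 !linear0 !mulr0 !addr0.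
      by rewrite !chi0 ?mulr0 ?addr0//; move: Sab Sab' => /SE + /SE; lia.
    have {Sab Sab'}[bq [ap|ap]] : b = q /\ (a = p \/ a = p + 1)
        by move: Sab Sab' => /SE + /SE; lia.
    + subst a b; rewrite /= !uin d2d2 !linear0.
      set X := chi' (dtotal_in A (p + 1) (q + 1) _); rewrite !chi0; try by lia.
      by rewrite !mulr0 !add0r !addr0 mulrA invfM mulrA mulfV ?mul1r.
    + subst a b; rewrite /= !uin d2d2 !linear0.
      set X := chi' (dtotal_in A (p + 1) (q + 1) _); rewrite !chi0; try by lia.
      by rewrite !mulr0 !add0r !addr0 mulrA mulfV ?mul1r.
(* At [(p, q)] the composite is multiplication by [(m00 * l01)^-1]. *)
have := NS s f p q (fvec F p q).
rewrite sE fcoordK// scale1r v00 fE => /eqP; rewrite scaler_eq0 => /orP[|/eqP]; last first.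
  exact: fvec_neq0.
rewrite uin; set X := chi' (dtotal_in A (p + 1) (q + 1) _); rewrite !chi0; try by lia.
rewrite !mulr0 !add0r /X /chi' /= dtotal_prK chi1 mulr1 invr_eq0 mulf_eq0.
by rewrite (negbTE m0) (negbTE l1).
Qed.

End SummandExists.

(** * Zigzags split off when d1 d2 = 0 *)

Section ZigzagSummand.
Variables (K : fieldType) (C : dshape -> dcomplex K).
Hypothesis hC : forall S : dshape, has_shape (C S) (sval S).
Variable A : dcomplex K.

Lemma dbounded_column : dbounded A ->
  exists N : nat, forall a b (x : A a b), (N < `|a|)%N -> x = 0.
Proof.
move=> /finite_seqP[s sE]; exists (\sum_(pq <- s) `|pq.1|)%N => a b x Na.
apply: contrapT => /eqP x0; have : [set pq | exists x : A pq.1 pq.2, x != 0] (a, b).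
  by exists x.
rewrite sE /= => abs; move: Na; rewrite (big_rem _ abs) /= ltnNge.
by rewrite leq_addr.
Qed.

Definition boundary : set (dtotal A) :=
  [set t | exists u v, t = D1 A u + D2 A v].

Hypothesis A12 : forall p q (x : A p q), d1 A p (q + 1) (d2 A p q x) = 0.

Lemma D1D2_eq0 t : D1 A (D2 A t) = 0.
Proof.
apply: (dtotal_ext (h := D1 A \o D2 A) (g := \0 : {linear dtotal A -> dtotal A})).
by move=> a b x; rewrite /= D2E D1E A12 linear0.
Qed.

Lemma D2D1_eq0 t : D2 A (D1 A t) = 0.
Proof. by rewrite D2D1 D1D2_eq0 oppr0. Qed.

Lemma boundary_D1 t : boundary t -> D1 A t = 0.
Proof. by move=> [u [v ->]]; rewrite linearD D1D1 D1D2_eq0 addr0. Qed.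

Lemma boundary_D2 t : boundary t -> D2 A t = 0.
Proof. by move=> [u [v ->]]; rewrite linearD D2D2 D2D1_eq0 addr0. Qed.

Lemma submodule_boundary : submodule boundary.
Proof.
split=> [|k _ _ [u [v ->]] [u' [v' ->]]].
  by exists 0, 0; rewrite !linear0 addr0.
by exists (k *: u + u'), (k *: v + v'); rewrite !linearP scalerDr addrACA.
Qed.

Lemma boundary_in_d1 a b x : boundary (dtotal_in A (a + 1) b (d1 A a b x)).
Proof. by exists (dtotal_in A a b x), 0; rewrite linear0 addr0 D1E. Qed.

Lemma boundary_in_d2 a b x : boundary (dtotal_in A a (b + 1) (d2 A a b x)).
Proof. by exists 0, (dtotal_in A a b x); rewrite linear0 add0r D2E. Qed.

(** Otherwise [x = D1 u + D2 v] with [u] and [v] boundaries themselves, and these are killed by both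
    differentials. *)
Lemma not_boundary_exists : (exists p q (x : A p q), x != 0) ->
  exists p q (x : A p q), ~ boundary (dtotal_in A p q x).
Proof.
move=> [p [q [x x0]]]; apply: contrapT => NB.
have B a b y : boundary (dtotal_in A a b y).
  by apply: contrapT => Nab; apply: NB; exists a, b, y.
have Ball t : boundary t.
  by apply: (dsum_ind submodule_boundary) => -[a b] y; exact: B.
have [u [v]] := Ball (dtotal_in A p q x).
rewrite boundary_D1 ?boundary_D2// addr0 => /eqP.
rewrite -[0](linear0 (dtotal_in A p q)) (inj_eq (@dtotal_in_inj _ A p q)).
by rewrite (negbTE x0).
Qed.

Lemma leftmost_not_boundary : dbounded A -> (exists p q (x : A p q), x != 0) ->
  exists p q, (exists x : A p q, ~ boundary (dtotal_in A p q x)) /\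
    forall a b y, a + b = p + q -> a < p -> boundary (dtotal_in A a b y).
Proof.
move=> /dbounded_column[N AN] /not_boundary_exists[p [q [x Nx]]].
(* Columns are shifted by [N], so that the leftmost one is a minimum over natural numbers. *)
pose P (n : nat) := `[< exists y : A (n%:Z - N%:Z) (p + q - (n%:Z - N%:Z)),
  ~ boundary (dtotal_in A _ _ y) >].
have bN a b y : (N < `|a|)%N -> boundary (dtotal_in A a b y).
  by move=> Na; rewrite (AN a b y Na) linear0; exact: submodule_boundary.1.
have exP : exists n, P n.
  have pN : (`|p| <= N)%N by rewrite leqNgt; apply/negP => /bN.
  exists (absz (p + N%:Z)%R); apply/asboolP.
  have -> : (absz (p + N%:Z)%R)%:Z - N%:Z = p by lia.
  have -> : p + q - p = q by lia.
  by exists x.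
have [n /asboolP[y Ny] nmin] := ex_minnP exP.
exists (n%:Z - N%:Z), (p + q - (n%:Z - N%:Z)); split; first by exists y.
move=> a b z ab an; apply: contrapT => Nz.
have aN : (`|a| <= N)%N by rewrite leqNgt; apply/negP => /bN.
have /nmin : P (absz (a + N%:Z)%R); last by lia.
apply/asboolP.
have -> : (absz (a + N%:Z)%R)%:Z - N%:Z = a by lia.
have -> : p + q - a = b by lia.
by exists z.
Qed.

(** A zigzag has no cycles, so rescaling is unobstructed: start with 1 at the first source and solve
    from one point to the next. *)
Lemma zigzag_weights (l m : nat -> K) (b : nat) (e left : bool) :
  (forall k, (k < b + e)%N -> l k != 0) ->
  (forall k, (~~ left <= k <= b)%N -> m k != 0) ->
  exists r rho : nat -> K,
  [/\ forall k, (k <= b)%N -> r k != 0,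
      forall k, (~~ left <= k <= b + e)%N -> rho k != 0,
      forall k, (k < b + e)%N -> r k = l k * rho k.+1
    & forall k, (~~ left <= k <= b)%N -> r k = m k * rho k].
Proof.
move=> l0 m0; pose r := fix r k := if k is k'.+1 then m k * (r k' / l k') else 1.
pose rho k := if k is k'.+1 then r k' / l k' else r 0%N / m 0%N.
have r0 k : (k <= b)%N -> r k != 0.
  elim: k => [_|k IH kb]; first exact: oner_neq0.
  by rewrite /= !mulf_neq0 ?invr_neq0 ?IH ?l0 ?m0//; lia.
exists r, rho; split=> // [[|k] kb|k kb|[|k] kb].
- by rewrite /rho mulf_neq0 ?invr_neq0 ?oner_neq0 ?m0//; lia.
- by rewrite /rho mulf_neq0 ?invr_neq0 ?r0 ?l0//; lia.
- by rewrite /rho mulrCA mulfV ?mulr1// l0.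
- by rewrite /rho mulrCA mulfV ?mulr1// m0.
- by [].
Qed.

Lemma zigzag_summand : dbounded A -> (exists p q (x : A p q), x != 0) ->
  exists S, ~ no_summand C A S.
Proof.
move=> Abd A0; have [N AN] := dbounded_column Abd.
have [p [q [[x0 Nx0] left0]]] := leftmost_not_boundary Abd A0.
pose P (k : nat) := dtotal_at A (p + k%:Z) (q - k%:Z).
pose f k : {linear dtotal A -> dtotal A} := D1 A \o P k.
pose g k : {linear dtotal A -> dtotal A} := D2 A \o P k.+1.
(* If [d2] vanishes on [A p q], the zigzag begins at this source and the functional there has to
   kill boundaries. Otherwise it begins at the target above, and the functional has to kill [ker d2]
   so as to factor through [d2]. *)
have [left [U [sU BU U0 [PU Uleft]]]] : exists (left : bool) (U : set (dtotal A)),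
    [/\ submodule U, forall t, boundary (P 0%N t) -> U t, exists w, ~ U w &
      (forall t, P 0%N t = 0 -> U t) /\
      if left then forall t, D2 A (P 0%N t) = 0 -> U t else forall t, D2 A (P 0%N t) = 0].
  have P0in y : P 0%N (dtotal_in A p q y) = dtotal_in A p q y.
    by rewrite /P !addr0 dtotal_at_in.
  have [d20|/existsNP[t0 d20]] := pselect (forall t, D2 A (P 0%N t) = 0).
    exists false, [set t | boundary (P 0%N t)]; split=> //.
    - split=> [|k u v /= Bu Bv].
        by rewrite /= !linear0; exact: submodule_boundary.1.
      rewrite /= !linearP; exact: (submodule_boundary.2 k _ _ Bu Bv).
    - exists (dtotal_in A p q x0); change (~ boundary (P 0%N (dtotal_in A p q x0))).
      by rewrite P0in.
    - by split=> // t /= ->; exact: submodule_boundary.1.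
  exists true, [set t | D2 A (P 0%N t) = 0]; split=> //.
  - split=> [|k u v /= Bu Bv]; first by rewrite /= !linear0.
    by rewrite !linearP Bu Bv scaler0 addr0.
  - by move=> t /boundary_D2.
  - by exists t0.
  - by split=> // t /= ->; rewrite linear0.
(* For such [k] the column [p + k] lies outside the support. *)
have fn k t : (N + `|p| < k)%N -> f k t = 0.
  move=> Nk; rewrite /f /= /P /dtotal_at /=.
  by rewrite (AN _ _ (dtotal_pr A (p + k%:Z) (q - k%:Z) t)) ?linear0 ?linear0//; lia.
have [|||b [e [x [phi [psi [[phi1 _] phiU rel psif endc]]]]]] :=
    @chain_exists K (dtotal A) (N + `|p|).+1 f g U setT sU _ _ _ fn.
- by split.
- by [].
- by have [w Uw] := U0; exists w.
have [psi0 psi0E] : exists h : {linear dtotal A -> K^o},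
    left -> forall t, h (D2 A (P 0%N t)) = phi 0%N t.
  have [lt|] := boolP left; last by exists \0.
  pose G : set (dtotal A * K^o)%type := [set z | exists t, z = (D2 A (P 0%N t), phi 0%N t)].
  have sG : submodule G.
    split=> [|k _ _ [t ->] [t' ->]]; first by exists 0; rewrite !linear0.
    by exists (k *: t + t'); rewrite !linearP.
  have [c|h hG] := @linear_extension K _ K^o G.
    move=> /(_ G sG (fun _ => id))[t [/esym t0 ->]]; apply: phiU.
    by move: Uleft; rewrite lt; exact.
  by exists h => _ t; apply: hG; exists t.
have [S SE] := zigzag_interval p q b left e.
exists S => NS; have [F] := dshape_frame hC S.
have [k kb|k kb|r [rho [r0 rho0 rl rm]]] := @zigzag_weights
    (fun k => fl F (p + k%:Z) (q - k%:Z)) (fun k => fm F (p + k%:Z) (q - k%:Z)) b e left.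
- by apply: fl_neq0; apply/SE; lia.
- by apply: fm_neq0; apply/SE; lia.
have PE k a c w : a = p + k%:Z -> c = q - k%:Z -> P k (dtotal_in A a c w) = dtotal_in A a c w.
  by move=> ea ec; subst a c; exact: dtotal_at_in.
have prP k t : dtotal_pr A (p + k%:Z) (q - k%:Z) (P k t) = dtotal_pr A (p + k%:Z) (q - k%:Z) t.
  exact: dtotal_prK.
(* Target [k] receives [d1] from source [k - 1] and [d2] from source [k]; target 0 belongs to the
   zigzag only if [left] holds. *)
pose y k := if k is k'.+1 then D1 A (P k' (x k')) else D2 A (P 0%N (x 0%N)).
have yD2 k : (k <= b)%N -> D2 A (P k (x k)) = y k.
  by case: k => // k /rel[fg _]; rewrite /y -[RHS]/(f k (x k)) fg.
have Dy1 k : D1 A (y k) = 0 by case: k => [|k]; [exact: D1D2_eq0|exact: D1D1].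
have Dy2 k : D2 A (y k) = 0 by case: k => [|k]; [exact: D2D2|exact: D2D1_eq0].
pose Psi k := if k is k'.+1 then psi k' else psi0.
have Psi1 k t : (k < b + e)%N -> Psi k.+1 (D1 A (P k t)) = phi k t by move=> kb; exact: psif.
have Psi2 k t : (~~ left <= k <= b)%N -> Psi k (D2 A (P k t)) = phi k t.
  by case: k => [|k] kb; [apply: psi0E; lia|apply: (rel k _).2; lia].
(* Arrows into a source come from outside the zigzag, so [phi] must kill their images: at index 0 by
   the choice of [U], later because [phi] factors through [d2]. *)
have phi_bd k a c w : (k <= b)%N -> a = p + k%:Z -> c = q - k%:Z ->
    boundary (dtotal_in A a c w) -> phi k (dtotal_in A a c w) = 0.
  case: k => [|k] kb ea ec Bw; first by apply: phiU; apply: BU; rewrite PE.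
  by rewrite -Psi2 ?PE//; [rewrite boundary_D2// linear0|lia].
(* The weights r (at sources) and rho (at targets) adapt the chain x and the  *)
(* functionals phi, psi to the matrix entries of C(S).                        *)
pose v a c := if a + c == p + q then r (absz (a - p)) *: dtotal_pr A a c (x (absz (a - p)))
  else rho (absz (a - p)) *: dtotal_pr A a c (y (absz (a - p))).
have vs k : v (p + k%:Z) (q - k%:Z) = r k *: dtotal_pr A _ _ (x k).
  rewrite /v ifT; last by lia.
  by have -> : absz (p + k%:Z - p)%R = k by lia.
have vt1 k : v (p + k%:Z + 1) (q - k%:Z) = rho k.+1 *: dtotal_pr A _ _ (y k.+1).
  rewrite /v ifF; last by lia.
  by have -> : absz (p + k%:Z + 1 - p)%R = k.+1 by lia.
have vt2 k : v (p + k%:Z) (q - k%:Z + 1) = rho k *: dtotal_pr A _ _ (y k).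
  rewrite /v ifF; last by lia.
  by have -> : absz (p + k%:Z - p)%R = k by lia.
have src a c : a + c = p + q -> p <= a <= p + b%:Z ->
    exists k, [/\ (k <= b)%N, a = p + k%:Z & c = q - k%:Z].
  by move=> ac ab; exists (absz (a - p)); split; lia.
have [s sE] : exists s : dmorphism (C S) A, forall a c z,
    s a c z = (fcoord F a c z : K) *: v a c.
  apply: frame_hom_from (hC S) _ _ => a c /SE[[ac ab]|[ac ab]].
  - have [k [kb ea ec]] := src _ _ ac ab; subst a c.
    have yS : y k.+1 = D1 A (P k (x k)) by [].
    rewrite vs vt1 yS dtotal_pr_D1 prP linearZ [LHS]/=.
    have [kbe|kbe] := boolP (k < b + e)%N; first by rewrite rl// scalerA.
    rewrite fl0; last by move=> -[_ /SE]; lia.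
    have [eF kE] : e = false /\ k = b by lia.
    move: endc; rewrite eF -kE => xb.
    by rewrite -prP -dtotal_pr_D1 [D1 _ _]xb linear0 scaler0 scale0r.
  - rewrite fl0; last by move=> -[_ /SE]; lia.
    rewrite /v ifF; last by lia.
    by rewrite linearZ /= -dtotal_pr_D1 Dy1 linear0 scaler0 scale0r.
  - have [k [kb ea ec]] := src _ _ ac ab; subst a c.
    rewrite vs vt2 linearZ [LHS]/= -yD2// dtotal_pr_D2 prP.
    have [kl|kl] := boolP (~~ left <= k)%N; first by rewrite rm ?kl// scalerA.
    rewrite fm0; last by move=> -[_ /SE]; lia.
    have [lF k0] : left = false /\ k = 0%N by lia.
    move: Uleft; rewrite lF k0 => x2.
    by rewrite -prP -dtotal_pr_D2 x2 linear0 scaler0 scale0r.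
  - rewrite fm0; last by move=> -[_ /SE]; lia.
    rewrite /v ifF; last by lia.
    by rewrite linearZ /= -dtotal_pr_D2 Dy2 linear0 scaler0 scale0r.
have ue a c : exists h : {linear A a c -> K^o}, forall z, h z =
    if a + c == p + q then (r (absz (a - p)))^-1 * phi (absz (a - p)) (dtotal_in A a c z)
    else (rho (absz (a - p)))^-1 * Psi (absz (a - p)) (dtotal_in A a c z).
  have [] := @linear_exists K (A a c) K^o (fun z =>
    if a + c == p + q then (r (absz (a - p)))^-1 * phi (absz (a - p)) (dtotal_in A a c z)
    else (rho (absz (a - p)))^-1 * Psi (absz (a - p)) (dtotal_in A a c z));
    last by move=> h; exists h.
  by move=> k z w; case: ifP => _; rewrite !linearP mulrDr mulrCA.
pose u a c := sval (cid (ue a c)).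
have us k z : u (p + k%:Z) (q - k%:Z) z = (r k)^-1 * phi k (dtotal_in A _ _ z).
  rewrite (svalP (cid (ue _ _))) ifT; last by lia.
  by have -> : absz (p + k%:Z - p)%R = k by lia.
have ut1 k z : u (p + k%:Z + 1) (q - k%:Z) z = (rho k.+1)^-1 * Psi k.+1 (dtotal_in A _ _ z).
  rewrite (svalP (cid (ue _ _))) ifF; last by lia.
  by have -> : absz (p + k%:Z + 1 - p)%R = k.+1 by lia.
have ut2 k z : u (p + k%:Z) (q - k%:Z + 1) z = (rho k)^-1 * Psi k (dtotal_in A _ _ z).
  rewrite (svalP (cid (ue _ _))) ifF; last by lia.
  by have -> : absz (p + k%:Z - p)%R = k by lia.
have [h hE] : exists h : dmorphism A (C S), forall a c z,
    h a c z = (u a c z : K) *: fvec F a c.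
  apply: (frame_hom_to (u := u)) (hC S) _ _ => a c z /SE[[ac ab]|[ac ab]].
  - rewrite fl0; last by move=> -[/SE]; lia.
    have [k [kb ea ec]] := src _ _ ac ab.
    have uk w : u (a + 1) c w = (r k)^-1 * phi k (dtotal_in A _ _ w).
      by clear z; rewrite ea ec in w *; exact: us.
    by rewrite uk (phi_bd k)// ?mulr0 ?mul0r//; exact: boundary_in_d1.
  (* Left of [p] the antidiagonal consists of boundaries, so [d1] brings nothing from there into the
     first target. *)
  - have [ap|pa] := ltP a p.
      rewrite fl0; last by move=> -[/SE]; lia.
      have z0 : D1 A (dtotal_in A a c z) = 0 by apply: boundary_D1; apply: left0 => //; lia.
      have -> : d1 A a c z = 0 by apply: dtotal_in_inj; rewrite -D1E z0 linear0.
      by rewrite linear0 mul0r.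
    have [k [kb ea ec]] : exists k, [/\ (k < b + e)%N, a = p + k%:Z & c = q - k%:Z].
      by exists (absz (a - p)); split; lia.
    subst a c; rewrite ut1 us -D1E -[dtotal_in _ _ _ z](PE k)// Psi1// PE//.
    by rewrite mulrA rl// invfM mulrA mulfV ?mul1r// fl_neq0//; apply/SE; lia.
  - rewrite fm0; last by move=> -[/SE]; lia.
    have [k [kb ea ec]] := src _ _ ac ab.
    have uk w : u a (c + 1) w = (r k)^-1 * phi k (dtotal_in A _ _ w).
      by clear z; rewrite ea ec in w *; exact: us.
    by rewrite uk (phi_bd k)// ?mulr0 ?mul0r//; exact: boundary_in_d2.
  - have [k [kb ea ec]] :
        exists k, [/\ (~~ left <= k <= b + e)%N, a = p + k%:Z & c = q - k%:Z].
      by exists (absz (a - p)); split; lia.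
    subst a c; rewrite ut2 us -D2E -[dtotal_in _ _ _ z](PE k)//.
    have [kb'|kb'] := leqP k b.
      rewrite Psi2 ?PE//; last by lia.
      rewrite mulrA rm//; last by lia.
      by rewrite invfM mulrA mulfV ?mul1r// fm_neq0//; apply/SE; lia.
    (* Only the target at the right end is left; its functional [psi b] kills the image of [g b]. *)
    rewrite fm0; last by move=> -[/SE]; lia.
    have [eT kE] : e = true /\ k = b.+1 by lia.
    by subst k; move: endc; rewrite eT => psib; rewrite [Psi _ _]psib mulr0 mul0r.
have S0 : sval S (p + 0%:Z, q - 0%:Z) by apply/SE; lia.
have := NS s h _ _ (fvec F (p + 0%:Z) (q - 0%:Z)).
rewrite sE fcoordK// scale1r (vs 0%N) hE us linearZ /= linearZ /= => /eqP.
rewrite scaler_eq0 => /orP[|/eqP]; last exact: fvec_neq0.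
rewrite -[dtotal_in _ _ _ _]/(P 0%N (x 0%N)).
(* [x 0] and its component at [(p, q)] differ by an element of [U]. *)
have -> : phi 0%N (P 0%N (x 0%N)) = 1.
  apply/esym/eqP; rewrite -phi1 -subr_eq0 -linearB; apply/eqP/phiU/PU.
  by rewrite linearB [X in _ - X]PE// subrr.
by rewrite -[_ *: _]/(r 0%N * 1) mulr1 mulVf ?r0// oner_eq0.
Qed.

End ZigzagSummand.

(** * Decomposition *)

Lemma subsets_finite (T : choiceType) (s : seq T) :
  exists l : seq (set T), forall X : set T, X `<=` [set` s] -> X \in l.
Proof.
elim: s => [|x s [l lP]].
  by exists [:: set0] => X Xs; rewrite mem_seq1; apply/eqP; rewrite -subset0 => y /Xs.
exists (l ++ [seq x |` Y | Y <- l]) => X Xs; rewrite mem_cat.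
have Xx : X `\ x \in l.
  by apply: lP => y [/Xs /=]; rewrite inE => /orP[/eqP|].
have [xX|xX] := pselect (X x); last by rewrite -(not_setD1 xX) Xx.
by apply/orP; right; apply/mapP; exists (X `\ x) => //; rewrite setD1K.
Qed.

Lemma disomorphic_sym (K : fieldType) (A B : dcomplex K) : disomorphic A B -> disomorphic B A.
Proof. by move=> [f [g fg]]; exists g, f => p q; have [] := fg p q. Qed.

Lemma disomorphic_trans (K : fieldType) (A B D : dcomplex K) :
  disomorphic A B -> disomorphic B D -> disomorphic A D.
Proof.
move=> [f [g fK]] [f' [g' fK']]; exists (dcompose f f'), (dcompose g' g) => p q.
by split=> x; rewrite !dcomposeE ?(fK' p q).1 ?(fK p q).1 ?(fK p q).2 ?(fK' p q).2.
Qed.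

Section Decomposition.
Variables (K : fieldType) (C : dshape -> dcomplex K).
Hypothesis hC : forall S : dshape, has_shape (C S) (sval S).

Lemma summand_exists (A : dcomplex K) :
  dbounded A -> (exists p q (x : A p q), x != 0) -> exists S, ~ no_summand C A S.
Proof.
move=> Abd A0.
have [[p [q [x dx]]]|N12] :=
    pselect (exists p q (x : A p q), d1 A p (q + 1) (d2 A p q x) <> 0).
  exact: (square_summand hC dx).
apply: (zigzag_summand hC) => // p q x; apply: contrapT => dx.
by apply: N12; exists p, q, x.
Qed.

(** The scalar by which a composite acts can be read off at [(a, b)], where it factors through 0. *)
Lemma no_summand_out (A : dcomplex K) S a b :
  sval S (a, b) -> (forall x : A a b, x = 0) -> no_summand C A S.
Proof.
move=> Sab A0 s f p q x; have [k kE] := dshape_endo hC (dcompose s f).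
rewrite -[LHS]/(dcompose s f p q x) kE; suff -> : k = 0 by rewrite scale0r.
have [F] := dshape_frame hC S; have := kE a b (fvec F a b).
rewrite dcomposeE (A0 (s _ _ _)) linear0 => /esym/eqP.
by rewrite scaler_eq0 => /orP[/eqP//|/eqP/(fvec_neq0 F Sab)].
Qed.

(** A family of shapes instead of multiplicities: families combine by disjoint union of index types,
    and grouping by shape is done once at the end. *)
Definition decomposable (A : dcomplex K) : Prop :=
  exists (J : Type) (s : J -> dshape), disomorphic A (dcsum (fun j => C (s j))).

(** [back] adds the two inclusions; its inverse combines [f] with the projection [x - s (f x)] onto
    the kernel. *)
Lemma decomposable_kernel (A : dcomplex K) (S : dshape) (J : Type)
    (s : dmorphism (dcsum (fun _ : J => C S)) A)
    (f : dmorphism A (dcsum (fun _ : J => C S))) :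
  (forall p q x, f p q (s p q x) = x) -> decomposable (dkernel f) -> decomposable A.
Proof.
move=> fs [J' [t [phi [psi phiK]]]].
pose r (j : J + J') := if j is inr j' then t j' else S.
pose B j := C (r j).
pose h (j : J + J') : dmorphism (B j) A :=
  match j return dmorphism (B j) A with
  | inl i => dcompose (dcsum_in (fun _ : J => C S) i) s
  | inr i => dcompose (dcompose (dcsum_in (fun i => C (t i)) i) psi) (dkernel_in f)
  end.
pose e1 : dmorphism (dcsum (fun _ : J => C S)) (dcsum B) :=
  dcsum_lift (fun j => dcsum_in B (inl j)).
pose e2 : dmorphism (dcsum (fun j => C (t j))) (dcsum B) :=
  dcsum_lift (fun j => dcsum_in B (inr j)).
pose back : dmorphism (dcsum B) A := dcsum_lift h.
pose pr := dkernel_pr fs.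
pose fwd p q : {linear A p q -> dcsum B p q} :=
  (e1 p q \o f p q) \+ (e2 p q \o (phi p q \o pr p q)).
have be1 p q z : back p q (e1 p q z) = s p q z.
  apply: (dsum_ext (h := back p q \o e1 p q) (g := s p q)) z => j z /=.
  by rewrite dsum_liftE; exact: (dsum_liftE (fun i => h i p q) (i := inl j) z).
have be2 p q z : back p q (e2 p q z) = dkernel_in f p q (psi p q z).
  apply: (dsum_ext (h := back p q \o e2 p q) (g := dkernel_in f p q \o psi p q)) z => j z /=.
  by rewrite dsum_liftE; exact: (dsum_liftE (fun i => h i p q) (i := inr j) z).
have prs p q z : pr p q (s p q z) = 0.
  by apply: dkernel_in_inj; rewrite dkernel_prE fs subrr linear0.
exists (J + J')%type, r.
apply: disomorphic_sym; apply: (bijective_disomorphic (f := back)) => p q.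
exists (fwd p q) => z.
  apply: (dsum_ext (h := fwd p q \o back p q) (g := idfun)) z => j z.
  transitivity (fwd p q (h j p q z)).
    by apply: (congr1 (fwd p q)); exact: (dsum_liftE (fun i => h i p q) (i := j) z).
  case: j z => j z; rewrite /fwd /=.
    by rewrite fs prs !linear0 addr0; exact: (dsum_liftE _ (i := j) z).
  rewrite dkernel_inP linear0 add0r dkernel_prK (phiK p q).2.
  exact: (dsum_liftE _ (i := j) z).
rewrite /fwd /= linearD [X in X + _]be1 [X in _ + X]be2 (phiK p q).1 dkernel_prE.
by rewrite addrC subrK.
Qed.

Lemma dbounded_kernel (A B : dcomplex K) (f : dmorphism A B) :
  dbounded A -> dbounded (dkernel f).
Proof.
apply: sub_finite_set => -[a b] [/= x x0]; exists (dkernel_in f a b x).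
apply: contra x0 => /eqP x0; apply/eqP; apply: (@dkernel_in_inj _ _ _ f).
by rewrite x0 linear0.
Qed.

Lemma decomposable_bounded (A : dcomplex K) : dbounded A -> decomposable A.
Proof.
move=> Abd; have [r rE] := (finite_seqP _).1 Abd.
have [l lP] := subsets_finite r.
(* Only this property of [l] enters the induction: each peeling removes an entry of [l], whereas the
   support need not shrink. *)
have {r rE lP} : forall S, ~ no_summand C A S -> sval S \in l.
  move=> S NS; apply: lP => -[a b] Sab; rewrite -rE /=.
  apply: contrapT => Nab; apply/NS/(no_summand_out Sab) => x.
  by apply: contrapT => /eqP x0; apply: Nab; exists x.
elim: l A Abd => [|X l IH] A Abd Al.
  have A0 p q (x : A p q) : x = 0.
    apply: contrapT => /eqP x0; have [|S /Al//] := summand_exists Abd.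
    by exists p, q, x.
  exists void, (fun v : void => match v with end).
  pose z p q : {linear A p q -> dcsum (fun v : void => C match v with end) p q} := \0.
  have V0 p q (y : dcsum (fun v : void => C match v with end) p q) : y = 0.
    by apply: dsum_prP => -[].
  have z1 p q x : z (p + 1) q (d1 A p q x) =
      d1 (dcsum (fun v : void => C match v with end)) p q (z p q x) by rewrite linear0.
  have z2 p q x : z p (q + 1) (d2 A p q x) =
      d2 (dcsum (fun v : void => C match v with end)) p q (z p q x) by rewrite linear0.
  apply: (bijective_disomorphic (f := DMorphism z1 z2)) => p q.
  by exists (fun=> 0) => x; [rewrite [RHS]A0|rewrite [RHS]V0].
have [[S [SX NS]]|NX] := pselect (exists S, sval S = X /\ ~ no_summand C A S); last first.
  apply: IH => // S NS; have := Al S NS; rewrite inE => /orP[/eqP SX|//].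
  by case: NX; exists S.
have [J [s [f [fs nosum]]]] := peel hC A S.
apply: (decomposable_kernel fs); apply: IH; first exact: dbounded_kernel.
move=> S' NS'; have : ~ no_summand C A S'.
  apply: contra_not NS' => NA s' f' p q x.
  have := NA (dcompose s' (dkernel_in f)) (dcompose (dkernel_pr fs) f') p q x.
  by rewrite !dcomposeE dkernel_prK.
move=> /Al; rewrite inE => /orP[/eqP SX'|//].
have SS' : S' = S by apply: dshape_eq; rewrite SX SX'.
by case: NS'; rewrite SS'; exact: nosum.
Qed.

Lemma dcsum_regroup (J : Type) (s : J -> dshape) :
  disomorphic (dcsum (fun j => C (s j))) (shape_sum C (fun S => {j | s j = S})).
Proof.
pose m S := {j | s j = S}; pose B j := C (s j).
pose up : dmorphism (dcsum B) (shape_sum C m) := dcsum_lift (fun j =>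
  dcompose (dcsum_in (fun _ : m (s j) => C (s j)) (exist _ j erefl))
    (dcsum_in (fun S => dcsum (fun _ : m S => C S)) (s j)) : dmorphism (B j) _).
(* An index in [m S] carries a proof of [s j = S], along which the inclusion of the [j]-th summand
   is transported. *)
pose cst S (je : m S) : dmorphism (C S) (dcsum B) :=
  match proj2_sig je in _ = S' return dmorphism (C S') (dcsum B) with
  | erefl => dcsum_in B (sval je)
  end.
pose dn : dmorphism (shape_sum C m) (dcsum B) :=
  dcsum_lift (fun S => dcsum_lift (@cst S)).
pose in1 S je := dcsum_in (fun _ : m S => C S) je.
pose in2 S := dcsum_in (fun S => dcsum (fun _ : m S => C S)) S.
have upE p q j x : up p q (dcsum_in B j p q x) =
    in2 (s j) p q (in1 (s j) (exist _ j erefl) p q x).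
  exact: (dsum_liftE _ (i := j) x).
have dnE p q S je x : dn p q (in2 S p q (in1 S je p q x)) = cst S je p q x.
  transitivity (dcsum_lift (@cst S) p q (in1 S je p q x)).
    exact: (dsum_liftE _ (i := S) _).
  exact: (dsum_liftE _ (i := je) x).
exists up, dn => p q; split.
  apply: (dsum_ext (h := dn p q \o up p q) (g := idfun)) => j x.
  by apply: etrans (congr1 (dn p q) (upE p q j x)) _;
    exact: (dnE p q (s j) (exist _ j erefl) x).
apply: (dsum_ext (h := up p q \o dn p q) (g := idfun)) => S y.
apply: (dsum_ext (h := up p q \o (dn p q \o in2 S p q)) (g := in2 S p q)) y => -[j jS] x.
apply: etrans (congr1 (up p q) (dnE p q S (exist _ j jS) x)) _.
by case: S / jS x => x; exact: upE.
Qed.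

(** [k^-1 s f] is idempotent. [U] is its image, written as an eigenspace so that membership is an
    equation, and [W] its kernel. [U] contains the nonzero image of [s], so [W] is zero and [f] is
    invertible. *)
Lemma indecomposable_summand (A : dcomplex K) S :
  dindecomposable A -> ~ no_summand C A S -> disomorphic A (C S).
Proof.
move=> [_ indec] NS.
have [s [f [p0 [q0 [x0 fs0]]]]] : exists (s : dmorphism (C S) A) (f : dmorphism A (C S)) p q x,
    f p q (s p q x) <> 0.
  apply: contrapT => N; apply: NS => s f p q x; apply: contrapT => fs.
  by apply: N; exists s, f, p, q, x.
have [k kE] := dshape_endo hC (dcompose s f).
have {}kE p q x : f p q (s p q x) = k *: x by exact: kE.
have k0 : k != 0 by apply/eqP => k0; apply: fs0; rewrite kE k0 scale0r.
pose U p q : {pred A p q} := fun y => s p q (f p q y) == k *: y.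
pose W p q : {pred A p q} := fun y => f p q y == 0.
have WU p q y : y - k^-1 *: s p q (f p q y) \in W p q.
  rewrite /W unfold_in linearB linearZ /= kE scalerA mulVf// scale1r.
  by rewrite subrr.
have sU : dsubcomplex U.
  split=> [p q|p q x|p q x]; rewrite /U.
  - split=> [|c x y]; rewrite !unfold_in ?linear0 ?scaler0// => /eqP xU /eqP yU.
    by rewrite !linearP /= xU yU.
  - by rewrite !unfold_in !dmap_d1 => /eqP ->; rewrite linearZ.
  - by rewrite !unfold_in !dmap_d2 => /eqP ->; rewrite linearZ.
have sW : dsubcomplex W.
  split=> [p q|p q x|p q x]; rewrite /W.
  - split=> [|c x y]; rewrite !unfold_in ?linear0// => /eqP xU /eqP yU.
    by rewrite !linearP /= xU yU scaler0 addr0.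
  - by rewrite !unfold_in !dmap_d1 => /eqP ->; rewrite linear0.
  - by rewrite !unfold_in !dmap_d2 => /eqP ->; rewrite linear0.
have UW : ddirect U W.
  move=> p q; split=> [y|y].
    exists (k^-1 *: s p q (f p q y)), (y - k^-1 *: s p q (f p q y)); split=> //.
      by rewrite /U unfold_in !linearZ /= kE linearZ /= !scalerA mulrC.
    exact: WU.
    by rewrite [RHS]addrC subrK.
  rewrite /U /W !unfold_in => /eqP yU /eqP yW.
  by move: yU; rewrite yW linear0 => /esym/eqP; rewrite scaler_eq0 (negbTE k0) => /eqP.
have [U0|W0] := indec U W sU sW UW.
  case: fs0; rewrite (U0 _ _ (s p0 q0 x0)) ?linear0//.
  by rewrite /U unfold_in kE linearZ.
apply: (bijective_disomorphic (f := f)) => p q.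
exists (fun y => k^-1 *: s p q y) => y.
  by apply/esym/eqP; rewrite -subr_eq0; apply/eqP; apply: W0; exact: WU.
by rewrite linearZ /= kE scalerA mulVf// scale1r.
Qed.

End Decomposition.

Theorem theorem1 (K : fieldType) (C : dshape -> dcomplex K)
    (hC : forall S : dshape, has_shape (C S) (sval S)) :
  (forall A : dcomplex K, dbounded A ->
     exists m : dshape -> Type,
       disomorphic A (shape_sum C m) /\
       forall m' : dshape -> Type, disomorphic A (shape_sum C m') ->
         forall S : dshape, same_card (m S) (m' S)) /\
  (forall A : dcomplex K, dbounded A -> dindecomposable A ->
     exists B : dcomplex K, (is_square B \/ is_zigzag B) /\ disomorphic A B).
Proof.
split=> [A Abd|A Abd Aind].
  have [J [s As]] := decomposable_bounded hC Abd.
  have Am := disomorphic_trans As (dcsum_regroup C s).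
  exists (fun S => {j | s j = S}); split=> // m' Am' S.
  have [f [g fg]] := disomorphic_trans (disomorphic_sym Am) Am'.
  have [i iI] := shape_sum_inj hC (fun p q => (fg p q).1) S.
  have [i' iI'] := shape_sum_inj hC (fun p q => (fg p q).2) S.
  exact: same_card_inj iI iI'.
have [S NS] := summand_exists hC Abd Aind.1.
exists (C S); split; last exact: (indecomposable_summand hC Aind NS).
by case: (svalP S) => SS; [left|right]; exists (sval S).
Qed.
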